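(* Let $N\ge 1$ and $k\ge 0$ be integers. The algebra $(V^{\mathrm{diff}})^{(k)}$ is finitely generated. More precisely, if for every $1\le i\le k+1$ one fixes a family $\mathcal{B}_i\subset (V_i^{\mathrm{diff}})^{(i-1)}$ inducing a basis of the quotient vector space $(V_i^{\mathrm{diff}})^{(i-1)}/(V_i^{\mathrm{diff}})^{(i-2)}$, then $$(V^{\mathrm{diff}})^{(k)}=\mathbb{C}[\mathcal{B}_1,\mathcal{B}_2,\dots,\mathcal{B}_{k+1}].$$
   Context: Fix $N\ge 1$. Consider formal variables $X_i^{(j)}$, $0\le i\le N$, $j\in\mathbb{N}$, and the algebra of differential polynomials $V=\mathbb{C}[X_i^{(j)}: 0\le i\le N,\ j\ge 0]$, graded by giving each variable degree $1$; $V_d$ is the degree-$d$ component. For $k\in\mathbb{N}$ put $V^{(k)}=\mathbb{C}[X_i^{(j)}: 0\le i\le N,\ 0\le j\le k]$. The group $\mathbb{C}[[T]]^{\times}$ acts on $V$ by algebra automorphisms: $\alpha\cdot P$ is obtained from $P$ by substituting $X_i^{(m)}\mapsto\sum_{j=0}^m\binom{m}{j}\alpha^{(m-j)}(0)X_i^{(j)}$, where $\alpha^{(s)}$ is the $s$-th formal derivative. $P\in V$ is differentially homogeneous of degree $d$ if $\alpha\cdot P=\alpha(0)^dP$ for all $\alpha\in\mathbb{C}[[T]]^\times$. Let $V_d^{\mathrm{diff}}\subset V_d$ be the space of such polynomials, $V^{\mathrm{diff}}=\bigoplus_{d}V_d^{\mathrm{diff}}$, $(V^{\mathrm{diff}})^{(k)}=V^{\mathrm{diff}}\cap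 V^{(k)}$ and $(V_d^{\mathrm{diff}})^{(k)}=V_d^{\mathrm{diff}}\cap V^{(k)}$. By convention $(V_1^{\mathrm{diff}})^{(-1)}=0$. $\mathbb{C}[\mathcal{B}_1,\dots,\mathcal{B}_{k+1}]$ denotes the subalgebra of $V$ generated by $\mathcal{B}_1\cup\dots\cup\mathcal{B}_{k+1}$. *)

(* Defs.v *)
From HB Require Import structures.
From mathcomp Require Export all_boot all_order all_algebra.
From mathcomp Require Export finmap monalg.
From mathcomp Require Export complex.
From mathcomp Require Export boolp classical_sets reals.

Set Implicit Arguments.
Unset Strict Implicit.
Unset Printing Implicit Defensive.

Import GRing.Theory.
Local Open Scope classical_set_scope.
Local Open Scope ring_scope.

(* The pair (i, j) indexes the variable X_i^(j). *)
Notation dmonom N := {cmonom ('I_N.+1 * nat)%type}.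
Notation dpoly C N := {malg C[dmonom N]}.

Section FormalPowerSeries.
Variable C : comNzRingType.

(* The sequence a stands for \sum_n a_n T^n. *)
Definition fps := nat -> C.

Definition fps_one : fps := fun n => (n == 0)%N%:R.

Definition fps_mul (a b : fps) : fps :=
  fun n => \sum_(j < n.+1) a j * b (n - j)%N.

Definition fps_unit (a : fps) : Prop := exists b, fps_mul a b = fps_one.

Definition fps_deriv (a : fps) : fps := fun n => n.+1%:R * a n.+1.

Definition fps_at0 (a : fps) : C := a 0%N.

End FormalPowerSeries.

Section Substitution.
Variables (C : comNzRingType) (I : choiceType) (A : comAlgType C).

(* The algebra morphism C[I] -> A sending the variable of index v to s v. *)
Definition subst (s : I -> A) (P : {malg C[{cmonom I}]}) : A :=
  mmap (fun c : C => c%:A)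
       (fun m : {cmonom I} => \prod_(v <- finsupp m) s v ^+ m v) P.

End Substitution.

Section Subalgebras.
Variables (C : nzRingType) (A : lalgType C).

Definition gen_subalg (S : set A) : set A :=
  smallest [set B : set A | GRing.subalg_closed (mem B)] S.

Definition finitely_generated (B : set A) : Prop :=
  exists s : seq A, B = gen_subalg [set` s].

End Subalgebras.

(* For subspaces U `<=` W: the elements of B lie in W and their classes are
   pairwise distinct and form a basis of W / U. *)
Definition basis_mod (C : nzRingType) (E : lmodType C) (W U B : set E) : Prop :=
  [/\ B `<=` W,
      forall (s : seq E) (c : E -> C), uniq s -> [set` s] `<=` B ->
        U (\sum_(b <- s) c b *: b) -> forall b, b \in s -> c b = 0
    & forall P : E, W P -> exists (s : seq E) (c : E -> C),
        [set` s] `<=` B /\ U (P - \sum_(b <- s) c b *: b)].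

Section DifferentiallyHomogeneous.
Variables (C : comNzRingType) (N : nat).
Local Notation V := (dpoly C N).

Definition dvar (i : 'I_N.+1) (j : nat) : V := << ucm (i, j) >>.

Definition Vdeg (d : nat) : set V :=
  [set P | forall m : dmonom N, m \in msupp P -> mdeg m = d].

(* V^(k) *)
Definition Vord (k : nat) : set V :=
  [set P | forall m : dmonom N, m \in msupp P ->
           forall (i : 'I_N.+1) (j : nat), m (i, j) != 0%N -> (j <= k)%N].

Definition fps_act (a : fps C) : V -> V :=
  subst (fun v : 'I_N.+1 * nat =>
    \sum_(j < v.2.+1)
      ('C(v.2, j)%:R * fps_at0 (iter (v.2 - j)%N (@fps_deriv C) a)) *: dvar v.1 j).

Definition diff_homogeneous (d : nat) (P : V) : Prop :=
  forall a : fps C, fps_unit a -> fps_act a P = fps_at0 a ^+ d *: P.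

Definition Vdiff_deg (d : nat) : set V :=
  [set P | Vdeg d P /\ diff_homogeneous d P].

(* The sum of the V_d^diff, which is direct since V_d^diff is contained in V_d. *)
Definition Vdiff : set V :=
  [set P | exists (n : nat) (f : nat -> V),
     (forall d, Vdiff_deg d (f d)) /\ P = \sum_(d < n) f d].

Definition Vdiff_ord (k : nat) : set V := Vdiff `&` Vord k.

(* The order bound is shifted by one: this is (V_d^diff)^(n-1), which is 0 by
   convention when n = 0. *)
Definition Vdiff_deg_ord_lt (d n : nat) : set V :=
  if n is k.+1 then Vdiff_deg d `&` Vord k else [set 0].

End DifferentiallyHomogeneous.

(* Main.v *)
From HB Require Import structures.
Require Import Defs.
From mathcomp Require Import perm zify.

(* Write X_i^[x] = X_i^(x) / x!, so that X_i(T) = sum_x X_i^[x] T^x and the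
   action of alpha is X_i(T) |-> alpha(T) X_i(T). Polarization turns P of degree
   d into one function f : N^d -> C for each word (i_1, ..., i_d), namely the
   iterated derivatives of P with respect to X_{i_1}^[x_1], ..., X_{i_d}^[x_d].
   Invariance of P under the units 1 / (1 - z T) says that f is killed by every
   complete homogeneous polynomial h_r, r > 0, in the shift operators
   x_p |-> x_p + 1, and P has order <= k iff f is supported in [0, k]^d.

   For lam_1 >= lam_2 >= ... of sum d, consider the condition that h_r of the
   shifts in a set S of positions kills f as soon as
   r + |S| > lam_1 + ... + lam_|S| (it is dual to the Tanisaki ideal of the
   Garsia-Procesi module). Such functions are exactly the combinations of
   products of shifted Vandermonde determinants over the blocks of partitions
   of the positions into blocks of sizes lam_1, lam_2, ...: induct on d, by
   removing the top slice of f in its first variable. For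
   lam = (k+1, ..., k+1, s) the condition follows from invariance and order
   <= k. Back in V, a shifted Vandermonde determinant becomes the generalized
   Wronskian det ([T^b] T^{m_a} X_{i_a}(T))_{a, b < n} with n <= k+1, which is
   differentially homogeneous of degree n and order <= n - 1. So these
   Wronskians generate, and by induction on n they lie in the algebra generated
   by B_1, ..., B_n. *)

Set Implicit Arguments.
Unset Strict Implicit.
Unset Printing Implicit Defensive.

Import Order.TTheory GRing.Theory Num.Theory.
Local Open Scope ring_scope.

(** * Contraction of tensors and Vandermonde functions *)

(** [kappa] encodes a set partition of the positions by naming the block of each;
    [mask (colour a kappa) s] keeps the coordinates of [s] in block [a]. *)
Definition colour (a : nat) (kappa : seq nat) : bitseq := map (eq_op^~ a) kappa.

Section Contraction.
Variables (C : comNzRingType) (B : nat).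

(** The pairing of [f], seen as a tensor on [0, B)^d, with the pure tensor [u]. Over [{poly C}] it
    yields the generating polynomials of the h_r; over differential polynomials it undoes
    polarization. *)
Fixpoint contract (A : comAlgType C) (u : seq (nat -> A)) (f : seq nat -> C) : A :=
  if u is v :: u' then \sum_(x < B) v x * contract u' (fun s => f ((x : nat) :: s))
  else (f [::])%:A.

Section Algebra.
Variable A : comAlgType C.
Implicit Types (u : seq (nat -> A)) (f g : seq nat -> C).

Lemma eq_contract u f g :
    (forall s, size s = size u -> all (fun x => x < B)%N s -> f s = g s) ->
  contract u f = contract u g.
Proof.
elim: u f g => [|v u IHu] f g fg /=; first by rewrite fg.
apply: eq_bigr => x _; congr (_ * _); apply: IHu => s sz_s s_lt.
by apply: fg; rewrite /= ?sz_s ?ltn_ord.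
Qed.

Lemma contract0 u : contract u (fun=> 0) = 0.
Proof.
elim: u => [|v u IHu] /=; first by rewrite scale0r.
by rewrite big1 // => x _; rewrite IHu mulr0.
Qed.

Lemma contract_lin u c f g :
  contract u (fun s => c * f s + g s) = c *: contract u f + contract u g.
Proof.
elim: u f g => [|v u IHu] f g /=; first by rewrite scalerDl scalerA.
rewrite scaler_sumr -big_split /=; apply: eq_bigr => x _.
by rewrite IHu mulrDr scalerAr.
Qed.

Lemma contract_sum (I : finType) u (c : I -> C) (f : I -> seq nat -> C) :
  contract u (fun s => \sum_i c i * f i s) = \sum_i c i *: contract u (f i).
Proof.
elim: u f => [|v u IHu] f /=.
  by rewrite scaler_suml; apply: eq_bigr => i _; rewrite scalerA.
under eq_bigr => x _ do rewrite IHu mulr_sumr.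
rewrite exchange_big; apply: eq_bigr => i _ /=.
by rewrite scaler_sumr; apply: eq_bigr => x _; rewrite scalerAr.
Qed.

Lemma contract_weightD u1 u2 (v v1 v2 : nat -> A) (c : A) f :
    (forall x, v x = v1 x + c * v2 x) ->
  contract (u1 ++ v :: u2) f =
    contract (u1 ++ v1 :: u2) f + c * contract (u1 ++ v2 :: u2) f.
Proof.
move=> Ev; elim: u1 f => [|w u1 IHu] f /=; last first.
  rewrite mulr_sumr -big_split; apply: eq_bigr => x _ /=.
  by rewrite IHu mulrDr [in RHS]mulrCA.
rewrite mulr_sumr -big_split; apply: eq_bigr => x _ /=.
by rewrite Ev mulrDl mulrA.
Qed.

(** Factors that depend on disjoint sets of variables contract independently. *)
Lemma contract_prod_mask q (kappa : seq nat) u (h : nat -> seq nat -> C) :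
    size kappa = size u -> all (fun a => a < q)%N kappa ->
  contract u (fun s => \prod_(a < q) h a (mask (colour a kappa) s)) =
  \prod_(a < q) contract (mask (colour a kappa) u) (h a).
Proof.
elim: kappa u h => [|c kappa IHk] [|v u] h //=.
  move=> _ _; elim/big_rec2: _ => [|a x y _ <-]; first by rewrite scale1r.
  by rewrite -scalerAl mul1r scalerA.
move=> [sz_k] /andP[c_lt k_lt].
rewrite (bigD1 (Ordinal c_lt)) //= eqxx /= mulr_suml; apply: eq_bigr => x _.
(* [h'] freezes the first coordinate inside the factor of its own block. *)
pose h' a (s : seq nat) := if c == a then h a (nat_of_ord x :: s) else h a s.
rewrite (@eq_contract _ _
  (fun s => \prod_(a < q) h' a (mask (colour a kappa) s))); last first.
  move=> s _ _; apply: eq_bigr => a _; rewrite /h' /=.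
  by case: (c == a).
rewrite IHk // (bigD1 (Ordinal c_lt)) //= -mulrA; congr (_ * (_ * _)).
  by apply: eq_contract => s _ _; rewrite /h' eqxx.
apply: eq_bigr => a; rewrite -val_eqE /= eq_sym => /negPf ca.
by rewrite ca /=; apply: eq_contract => s _ _; rewrite /h' ca.
Qed.

Lemma contract_prod_nth u (g : nat -> nat -> C) :
  contract u (fun s => \prod_(p < size u) g p (nth 0%N s p)) =
  \prod_(p < size u) \sum_(x < B) nth (fun=> 0) u p x * (g p x)%:A.
Proof.
elim: u g => [|v u IHu] g /=; first by rewrite !big_ord0 scale1r.
rewrite big_ord_recl mulr_suml; apply: eq_bigr => x _ /=.
rewrite -mulrA; congr (_ * _).
under eq_contract => s _ _ do rewrite big_ord_recl -[_ * _]addr0 /=.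
rewrite contract_lin contract0 addr0 (IHu (fun p => g p.+1)).
by rewrite mulr_algl.
Qed.

End Algebra.
End Contraction.

Section Vandermonde.
Variable C : comNzRingType.
Implicit Types s m : seq nat.

(* In the divided-power basis this is, up to a scalar, the Vandermonde
   determinant in size s variables. *)
Definition vdm s : C :=
  \det (\matrix_(a < size s, b < size s) (nth 0%N s a == b)%:R).

Lemma vdmE n s : size s = n ->
  vdm s = \det (\matrix_(a < n, b < n) (nth 0%N s a == b)%:R).
Proof. by move <-. Qed.

Lemma vdm_nil : vdm [::] = 1.
Proof. exact: det_mx00. Qed.

Lemma vdm_gt x s : (size s < x)%N -> vdm (x :: s) = 0.
Proof.
move=> x_gt; rewrite (@vdmE (size s).+1) // (expand_det_row _ ord0) big1 // => b _.
by rewrite mxE /= gtn_eqF ?mul0r // (leq_ltn_trans _ x_gt) // -ltnS.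
Qed.

(** The first row has its only 1 in the last column. Together with [vdm_gt] this describes the top
    slice of [vdm] in its first variable. *)
Lemma vdm_top s : vdm (size s :: s) = (-1) ^+ size s * vdm s.
Proof.
rewrite (@vdmE (size s).+1) // (expand_det_row _ ord0) (bigD1 ord_max) //= big1.
  rewrite mxE eqxx mul1r addr0 /cofactor /= add0n; congr (_ * \det _).
  by apply/matrixP => a b; rewrite !mxE /= /bump leqNgt ltn_ord.
move=> b /negPf; rewrite -val_eqE /= eq_sym => nb.
by rewrite mxE /= nb mul0r.
Qed.

(** In the divided-power reading, [vdm (shift m s)] as a function of [s] is a partial derivative of
    order [m] of the Vandermonde determinant. *)
Definition shift m s := [seq (p.1 + p.2)%N | p <- zip m s].

Lemma size_shift m s : size m = size s -> size (shift m s) = size s.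
Proof. by move=> sz; rewrite size_map size_zip sz minnn. Qed.

Lemma nth_shift m s p : size m = size s -> (p < size s)%N ->
  nth 0%N (shift m s) p = (nth 0 m p + nth 0 s p)%N.
Proof.
move=> sz p_lt; rewrite (nth_map (0, 0)%N) ?size_zip ?sz ?minnn //.
by rewrite nth_zip.
Qed.

Lemma mask_shift (b : bitseq) m s : size m = size s ->
  mask b (shift m s) = shift (mask b m) (mask b s).
Proof.
elim: b m s => [|[] b IHb] [|x m] [|y s] //= [sz];
  by rewrite -/(shift m s) IHb.
Qed.

Definition vdm_prod (q : nat) (kappa s : seq nat) : C :=
  \prod_(a < q) vdm (mask (colour a kappa) s).

(** The determinant is multilinear in its rows and row a involves the a-th variable only, so the
    contraction acts row by row. *)
Lemma contract_vdm (B : nat) (A : comAlgType C) (u : seq (nat -> A)) m n :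
    size u = n -> size m = n ->
  contract B u (fun s => vdm (shift m s)) =
  \det (\matrix_(a < n, b < n)
    \sum_(x < B) nth (fun=> 0) u a x * (nth 0%N m a + x == b)%N%:R).
Proof.
move=> <- sz_m.
(* [contract_prod_nth] takes factors indexed by [nat], while [sigma] acts on ordinals. *)
pose g (sigma : 'S_(size u)) p x : C :=
  if insub p is Some i then (nth 0%N m p + x == sigma i)%N%:R else 0.
rewrite (@eq_contract _ _ _ _ _ (fun s => \sum_(sigma : 'S_(size u))
    (-1) ^+ sigma * \prod_(p < size u) g sigma p (nth 0%N s p))); last first.
  move=> s sz_s _; rewrite (@vdmE (size u)) ?size_shift ?sz_m //.
  apply: eq_bigr => sigma _; congr (_ * _); apply: eq_bigr => p _.
  by rewrite mxE /g valK nth_shift ?sz_m ?sz_s.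
rewrite contract_sum; apply: eq_bigr => sigma _.
rewrite contract_prod_nth scaler_sign -mulr_sign; congr (_ * _).
apply: eq_bigr => p _; rewrite mxE; apply: eq_bigr => x _.
by rewrite /g valK scaler_nat.
Qed.

End Vandermonde.

(** * Vanishing conditions for complete homogeneous shifts, and spans of Vandermonde products *)

Lemma count_negb (c : bitseq) : (count id c + count negb c = size c)%N.
Proof. exact: count_predC. Qed.

Section Harmonic.
Variables (C : comNzRingType) (B : nat).
Implicit Types (c : bitseq) (s m : seq nat) (f : seq nat -> C) (lam : nat -> nat).

Definition geo (t : bool) (x y : nat) : {poly C} :=
  if t then (x <= y)%N%:R * 'X^(y - x) else (x == y)%:R.

(* Contraction of f with these weights at s is the generating polynomial
   sum_r h_r 'X^r, where h_r is the sum of the f (s + m) over the shifts m of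
   weight r supported in the set of positions c (truncated at the bound B). *)
Definition geos c s := [seq geo p.1 p.2 | p <- zip c s].

Lemma size_geos c s : size c = size s -> size (geos c s) = size s.
Proof. by move=> sz; rewrite size_map size_zip sz minnn. Qed.

Lemma nth_geos c s p (v : nat -> {poly C}) : size c = size s -> (p < size s)%N ->
  nth v (geos c s) p = geo (nth false c p) (nth 0%N s p).
Proof.
move=> sz p_lt; rewrite (nth_map (false, 0)%N) ?size_zip ?sz ?minnn //.
by rewrite nth_zip.
Qed.

Lemma mask_geos (b : bitseq) c s : size c = size s ->
  mask b (geos c s) = geos (mask b c) (mask b s).
Proof.
elim: b c s => [|[] b IHb] [|x c] [|y s] //= [sz];
  by rewrite -/(geos c s) IHb.
Qed.

(** Telescoping of the geometric series in the shift operator; it trades an unmarked position for a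
    marked one. *)
Lemma geo_true x y : geo false x y = geo true x y - 'X * geo true x.+1 y.
Proof.
rewrite /geo; have [xy|xy|->] := ltngtP x y; last first.
- by rewrite subnn expr0 mul0r mulr0 subr0 mul1r.
- by rewrite !mul0r mulr0 subr0.
by rewrite !mul1r -exprS subnSK // subrr.
Qed.

Lemma contract_geos_count0 c s f r : count id c = 0%N -> (0 < r)%N ->
  (contract B (geos c s) f)`_r = 0.
Proof.
move=> c0 r_gt0; elim: c s f c0 => [|[] c IHc] [|x s] f //= c0;
  rewrite ?coef_alg ?coefZ ?coef1 1?(gtn_eqF r_gt0) ?mulr0 //.
rewrite coef_sum big1 // => y _; rewrite /geo.
by case: eqP => _; rewrite ?mul1r ?mul0r ?coef0 ?IHc.
Qed.

(** Each marked position contributes a degree of at most B - 1, since its variable stays below B. *)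
Lemma contract_geos_count c s f r :
    (count id c * B.-1 < r)%N -> (contract B (geos c s) f)`_r = 0.
Proof.
elim: c s f r => [|t c IHc] [|x s] f r /= r_gt;
  rewrite ?coef_alg ?coefZ ?coef1 1?gtn_eqF ?mulr0 //; try by case: r r_gt.
rewrite coef_sum big1 // => y _; rewrite /geo; case: t r_gt => /= r_gt.
  have [xy|_] := leqP x y; last by rewrite !mul0r coef0.
  rewrite mul1r coefXnM; case: ltnP => // r_ge; apply: IHc.
  have := ltn_ord y; nia.
by case: eqP => _; rewrite ?mul1r ?mul0r ?coef0 ?IHc.
Qed.

(* Dualises the identity e_r(x_a : a notin c) = +- h_r(x_a : a in c) modulo
   the symmetric polynomials without constant term. *)
Lemma contract_geos_compl d f :
    (forall s r, size s = d -> (0 < r)%N ->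
      (contract B (geos (nseq d true) s) f)`_r = 0) ->
  forall c s r, size c = d -> size s = d -> (count negb c < r)%N ->
  (contract B (geos c s) f)`_r = 0.
Proof.
move=> f_full c; move: {2}(count negb c) (erefl (count negb c)) => n.
elim: n c => [|n IHn] c cn s r sz_c sz_s; rewrite cn => r_gt.
  suff -> : c = nseq d true by apply: f_full.
  rewrite -sz_c; apply/all_pred1P; move/eqP: cn; rewrite -leqn0 leqNgt -has_count.
  by rewrite -all_predC; apply: sub_all => -[].
have /(nthP false)[p p_lt nth_p] : false \in c.
  by have: has negb c by [rewrite has_count cn]; case/hasP=> -[].
have sp_lt : (p < size s)%N by rewrite sz_s -sz_c.
have cE : c = take p c ++ false :: drop p.+1 c.
  by rewrite -{1}(cat_take_drop p c) (drop_nth false p_lt) nth_p.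
have sE : s = take p s ++ nth 0%N s p :: drop p.+1 s.
  by rewrite -drop_nth // cat_take_drop.
have := size_takel (ltnW sp_lt); have := size_takel (ltnW p_lt).
move: (take p c) (drop p.+1 c) (take p s) (drop p.+1 s) (nth _ s p) cE sE
  => c1 c2 s1 s2 x cE sE sz1 sz2.
have geosE t y : geos (c1 ++ t :: c2) (s1 ++ y :: s2) =
    geos c1 s1 ++ geo t y :: geos c2 s2.
  by rewrite /geos zip_cat ?map_cat ?sz1.
have IH y k : (n < k)%N ->
    (contract B (geos (c1 ++ true :: c2) (s1 ++ y :: s2)) f)`_k = 0.
  have cn' : count negb (c1 ++ true :: c2) = n.
    by move: cn; rewrite cE !count_cat /= addnS add0n => -[].
  move=> n_lt; apply: IHn; rewrite ?cn' //.
    by rewrite -sz_c cE !size_cat.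
  by rewrite -sz_s sE !size_cat.
(* Coefficient r splits into coefficients r and r - 1 with position p marked; both exceed n. The
   second one starts from x + 1, which is why [IH] holds for every y. *)
rewrite cE sE geosE (contract_weightD _ _ _ (v1 := geo true x)
  (v2 := geo true x.+1) (c := - 'X)); last by move=> y; rewrite geo_true mulNr.
rewrite -!geosE mulNr coefD coefN coefXM IH ?add0r; last exact: ltnW.
by case: r r_gt => // r r_gt; rewrite IH ?oppr0.
Qed.

(** The weights multiply the matrix of the determinant by a unitriangular matrix of powers of 'X, so
    the result is constant in 'X. *)
Lemma contract_vdm_full n m s r : (n <= B)%N -> size m = n -> size s = n ->
    (0 < r)%N ->
  (contract B (geos (nseq n true) s) (fun t => vdm C (shift m t)))`_r = 0.
Proof.
move=> nB sz_m sz_s r_gt0.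
have sz_n : size (nseq n true) = size s by rewrite size_nseq.
rewrite (contract_vdm _ (n := n)) ?size_geos //.
pose M : 'M[C]_n := \matrix_(a, b) (nth 0 m a + nth 0 s a == b)%N%:R.
pose Z : 'M[{poly C}]_n := \matrix_(b, a) geo true a b.
have -> : (\matrix_(a < n, b < n) \sum_(x < B) nth (fun=> 0) (geos (nseq n true) s) a x *
    ((nth 0 m a + x)%N == b)%:R) = map_mx polyC M *m Z^T :> 'M[{poly C}]_n.
  apply/matrixP => a b; rewrite !mxE.
  set x := nth 0%N m a; set y := nth 0%N s a.
  transitivity (geo true (x + y) b).
    have -> : nth (fun=> 0) (geos (nseq n true) s) a = geo true y.
      by rewrite (nth_geos _ sz_n) ?sz_s // nth_nseq ltn_ord.
    have [xb|bx] := leqP x b.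
      have bxB : (b - x < B)%N by have := ltn_ord b; lia.
      rewrite (bigD1 (Ordinal bxB)) //= subnKC // eqxx mulr1 big1 ?addr0.
        by rewrite /geo leq_subRL // subnDA.
      move=> i; rewrite -val_eqE /= => /eqP i_neq.
      by case: eqP => [?|_]; [lia | rewrite mulr0].
    rewrite big1; first by rewrite /geo leqNgt ltn_addr // mul0r.
    by move=> i _; case: eqP => [?|_]; [lia | rewrite mulr0].
  have [xy_lt|xy_ge] := ltnP (x + y) n.
    rewrite (bigD1 (Ordinal xy_lt)) //= !mxE /= eqxx mul1r big1 ?addr0 // => i.
    by rewrite -val_eqE /= eq_sym !mxE => /negPf ->; rewrite mul0r.
  (* Here row a of [M] is zero, and so is the weight, because b < n <= x + y. *)
  rewrite /geo leqNgt (leq_trans (ltn_ord b)) // mul0r big1 // => i _.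
  by rewrite !mxE gtn_eqF ?mul0r // (leq_trans (ltn_ord i)).
rewrite det_mulmx det_map_mx det_tr det_trig; last first.
  by apply/is_trig_mxP => b a ba; rewrite mxE /geo leqNgt ba mul0r.
rewrite big1 ?mulr1 ?coefC ?gtn_eqF // => a _.
by rewrite mxE /geo leqnn subnn expr0 mul1r.
Qed.

(** A block met by [c] in e > 0 positions gives degree at most n - e, a block missed by [c] gives
    degree 0; products over blocks need both cases. *)
Lemma contract_vdm_bound n m c s r :
    (n <= B)%N -> size m = n -> size c = n -> size s = n ->
    (0 < r)%N -> ((0 < count id c)%N -> n < r + count id c)%N ->
  (contract B (geos c s) (fun t => vdm C (shift m t)))`_r = 0.
Proof.
move=> nB sz_m sz_c sz_s r_gt0 cr.
have [c0|c_gt0] := posnP (count id c); first exact: contract_geos_count0.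
apply: (@contract_geos_compl n) => // [t k ? ?|]; first exact: contract_vdm_full.
by have := count_negb c; have := cr c_gt0; rewrite sz_c; lia.
Qed.

Definition vanishing lam d f := forall c s r, size c = d -> size s = d ->
  (\sum_(a < count id c) lam a < r + count id c)%N ->
  (contract B (geos c s) f)`_r = 0.

(** There are at most \sum e indices with e > 0, and the first parts of [lam] are the largest. *)
Lemma leq_sum_support lam q (e : nat -> nat) :
    (forall a, lam a.+1 <= lam a)%N ->
  (\sum_(a < q | (0 < e a)%N) lam a <= \sum_(a < \sum_(a < q) e a) lam a)%N.
Proof.
move=> lamS; have lam_homo : {homo lam : a b / (a <= b)%N >-> (b <= a)%N}.
  exact: homo_leq (@leqnn) (fun _ _ _ ab bc => leq_trans bc ab) lamS.
pose n := (\sum_(a < q) (0 < e a))%N.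
have n_le : (n <= \sum_(a < q) e a)%N by apply: leq_sum => a _; case: (e a).
apply: (@leq_trans (\sum_(a < n) lam a)); last first.
  by rewrite -(subnKC n_le) big_split_ord leq_addr.
rewrite {n_le}/n; elim: q => [|q IHq]; first by rewrite big_ord0.
rewrite big_mkcond !big_ord_recr -big_mkcond /=.
case: (e q) => [|eq]; first by rewrite !addn0.
rewrite addn1 big_ord_recr leq_add //= lam_homo //.
by rewrite -[leqRHS]card_ord -sum1_card leq_sum // => a _; case: (e a).
Qed.

Lemma coef_prod_bound q (p : nat -> {poly C}) (b : nat -> nat) r :
    (forall a k, (a < q)%N -> (b a < k)%N -> (p a)`_k = 0) ->
  (\sum_(a < q) b a < r)%N -> (\prod_(a < q) p a)`_r = 0.
Proof.
move=> pb; apply/leq_sizeP: r; elim: q pb => [|q IHq] pb.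
  by rewrite !big_ord0 size_poly1.
rewrite !big_ord_recr /=; apply: leq_trans (size_polyMleq _ _) _.
have := IHq (fun a k aq => pb a k (ltnW aq)).
have /leq_sizeP : forall k, ((b q).+1 <= k)%N -> (p q)`_k = 0 by move=> k; apply: pb.
move=> sz_q sz_prod; rewrite -subn1 leq_subLR.
by apply: leq_trans (leq_add sz_prod sz_q) _; rewrite addnS addSn add1n.
Qed.

Lemma count_mask_colour q kappa c : size kappa = size c ->
    all (fun a => a < q)%N kappa ->
  (\sum_(a < q) count id (mask (colour a kappa) c))%N = count id c.
Proof.
elim: kappa c => [|x kappa IHk] [|t c] //=; first by move=> _ _; rewrite big1.
move=> [sz_k] /andP[x_lt k_lt]; rewrite -(IHk c) // (bigD1 (Ordinal x_lt)) //=.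
rewrite [in RHS](bigD1 (Ordinal x_lt)) //= eqxx /= addnA; congr (_ + _)%N.
by apply: eq_bigr => a; rewrite -val_eqE /= eq_sym => /negPf ->.
Qed.

Lemma size_mask_colour (T : Type) a kappa (s : seq T) : size s = size kappa ->
  size (mask (colour a kappa) s) = count_mem a kappa.
Proof. by move=> sz; rewrite size_mask ?count_map ?size_map. Qed.

(** The generating polynomial factors over the blocks. Its degree is at most the sum of lam a - e a
    over the blocks met by [c], which [leq_sum_support] compares with the first parts of [lam]. *)
Lemma vanishing_vdm_prod lam q d kappa m :
    (forall a, lam a.+1 <= lam a)%N -> (lam 0%N <= B)%N ->
    size kappa = d -> size m = d -> all (fun a => a < q)%N kappa ->
    (forall a, (a < q)%N -> count_mem a kappa = lam a) ->
  vanishing lam d (fun s => vdm_prod C q kappa (shift m s)).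
Proof.
move=> lamS lam_le sz_k sz_m k_lt k_lam c s r sz_c sz_s r_gt.
have lam_homo : {homo lam : a b / (a <= b)%N >-> (b <= a)%N}.
  exact: homo_leq (@leqnn) (fun _ _ _ ab bc => leq_trans bc ab) lamS.
have sz_g : size (geos c s) = d by rewrite size_geos ?sz_c.
pose h a t := vdm C (shift (mask (colour a kappa) m) t).
rewrite (@eq_contract _ _ _ _ _
  (fun t => \prod_(a < q) h a (mask (colour a kappa) t))); last first.
  move=> t sz_t _; apply: eq_bigr => a _.
  by rewrite /h mask_shift // sz_m sz_t.
rewrite contract_prod_mask ?sz_g //.
pose e a := count id (mask (colour a kappa) c).
have e_le a : (a < q)%N -> (e a <= lam a)%N.
  move=> aq; rewrite -k_lam // -(@size_mask_colour _ _ _ c) ?sz_c //.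
  exact: count_size.
apply: (coef_prod_bound (b := fun a => if (0 < e a)%N then (lam a - e a)%N else 0%N)
  (p := fun a => contract B (mask (colour a kappa) (geos c s)) (h a))).
  move=> a k aq k_gt; rewrite mask_geos ?sz_c //.
  apply: (@contract_vdm_bound (lam a)).
  - exact: leq_trans (lam_homo _ _ (leq0n a)) lam_le.
  - by rewrite size_mask_colour ?k_lam // sz_m.
  - by rewrite size_mask_colour ?k_lam // sz_c.
  - by rewrite size_mask_colour ?k_lam // sz_s.
  - by case: (0 < e a)%N k_gt => //; lia.
  - by move=> e_gt0; move: k_gt; rewrite e_gt0; rewrite -/(e a); lia.
rewrite -big_mkcond /=.
rewrite -(ltn_add2r (count id c)); apply: leq_ltn_trans r_gt.
have <- : (\sum_(a < q) e a = count id c)%N by apply: count_mask_colour; rewrite ?sz_c.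
apply: leq_trans (leq_sum_support q e lamS).
rewrite [X in (_ + X)%N](_ : \sum_(a < q) e a = \sum_(a < q | (0 < e a)%N) e a)%N; last first.
  by rewrite [RHS]big_mkcond; apply: eq_bigr => a _; case: (e a).
rewrite -big_split /=.
by under eq_bigr => a _ do rewrite subnK ?e_le //.
Qed.

(** [vdm_span_ext] identifies functions that agree on [0, B)^d, whose values are all that [contract]
    sees. *)
Inductive vdm_span lam q d : (seq nat -> C) -> Prop :=
| vdm_span_gen kappa m : size kappa = d -> size m = d ->
    all (fun a => a < q)%N kappa -> all (fun x => x < B)%N m ->
    (forall a, (a < q)%N -> count_mem a kappa = lam a) ->
    vdm_span lam q d (fun s => vdm_prod C q kappa (shift m s))
| vdm_span0 : vdm_span lam q d (fun=> 0)
| vdm_span_lin (c : C) f g : vdm_span lam q d f -> vdm_span lam q d g ->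
    vdm_span lam q d (fun s => c * f s + g s)
| vdm_span_ext f g : vdm_span lam q d f ->
    (forall s, size s = d -> all (fun x => x < B)%N s -> f s = g s) ->
    vdm_span lam q d g.

Lemma vanishing_lin lam d (c : C) f g : vanishing lam d f -> vanishing lam d g ->
  vanishing lam d (fun s => c * f s + g s).
Proof.
move=> f0 g0 e s r sz_e sz_s r_gt.
by rewrite contract_lin coefD coefZ f0 ?g0 // mulr0 addr0.
Qed.

Lemma vanishing_vdm_span lam q d f :
    (forall a, lam a.+1 <= lam a)%N -> (lam 0%N <= B)%N ->
  vdm_span lam q d f -> vanishing lam d f.
Proof.
move=> lamS lam_le; elim=> {f}.
- by move=> kappa m *; apply: vanishing_vdm_prod.
- by move=> c s r *; rewrite contract0 coef0.
- by move=> c f g _ f0 _ g0; apply: vanishing_lin.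
move=> f g _ f0 fg c s r sz_c sz_s r_gt.
rewrite -(@eq_contract _ _ _ _ f) ?f0 // => t.
by rewrite size_geos ?sz_c // sz_s; apply: fg.
Qed.

(** The new first position joins block [a0]. Shifting it by lam' a0 - i places the top slice of the
    enlarged determinant at i, where it is the old determinant up to sign. *)
Lemma vdm_span_lift lam lam' a0 i q d g :
    (a0 < q)%N -> (forall a, lam a = (a == a0) + lam' a)%N ->
    (i < lam a0 <= B)%N -> vdm_span lam' q d g ->
  exists f, vdm_span lam q d.+1 f /\
    forall s, size s = d -> all (fun x => x < B)%N s ->
      f (i :: s) = g s /\ forall x, (i < x)%N -> f (x :: s) = 0.
Proof.
move=> a0q lamE /andP[i_lt lam_le]; elim=> {g}.
- move=> kappa m sz_k sz_m k_lt m_lt k_lam.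
  have lam'_a0 : lam a0 = (lam' a0).+1 by rewrite lamE eqxx.
  pose x0 := (lam' a0 - i)%N.
  (* The sign cancels that of [vdm_top]. *)
  exists (fun s => (-1) ^+ lam' a0 *
    vdm_prod C q (a0 :: kappa) (shift (x0 :: m) s) + 0); split.
    apply: vdm_span_lin; last exact: vdm_span0.
    apply: vdm_span_gen; rewrite /= ?sz_k ?sz_m ?a0q ?m_lt ?andbT //.
      by rewrite /x0; lia.
    by move=> a aq; rewrite k_lam // lamE eq_sym.
  move=> s sz_s _.
  have prodE x : vdm_prod C q (a0 :: kappa) (shift (x0 :: m) (x :: s)) =
      vdm C ((x0 + x)%N :: mask (colour a0 kappa) (shift m s)) *
      \prod_(a < q | a != Ordinal a0q) vdm C (mask (colour a kappa) (shift m s)).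
    rewrite /vdm_prod (bigD1 (Ordinal a0q)) //= eqxx; congr (_ * _).
    by apply: eq_bigr => a; rewrite -val_eqE /= eq_sym => /negPf ->.
  have sz_a0 : size (mask (colour a0 kappa) (shift m s)) = lam' a0.
    by rewrite size_mask_colour ?k_lam ?size_shift ?sz_s.
  split=> [|x x_gt]; rewrite addr0 prodE; last first.
    by rewrite vdm_gt ?mul0r ?mulr0 // sz_a0 /x0; lia.
  have -> : (x0 + i)%N = lam' a0 by rewrite /x0; lia.
  rewrite -{2}sz_a0 vdm_top sz_a0 !mulrA -expr2 sqrr_sign mul1r.
  by rewrite /vdm_prod [RHS](bigD1 (Ordinal a0q)).
- by exists (fun=> 0); split; [apply: vdm_span0|].
- move=> c g1 g2 _ [f1 [f1_span f1E]] _ [f2 [f2_span f2E]].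
  exists (fun s => c * f1 s + f2 s); split; first exact: vdm_span_lin.
  move=> s sz_s s_lt; have [-> f1_0] := f1E s sz_s s_lt.
  have [-> f2_0] := f2E s sz_s s_lt; split=> // x ix.
  by rewrite f1_0 ?f2_0 // mulr0 addr0.
move=> g1 g2 _ [f [f_span fE]] gE; exists f; split=> // s sz_s s_lt.
by have [-> f0] := fE s sz_s s_lt; rewrite gE.
Qed.

(** Slice x of the first variable enters with weight 'X^x. Slices above i are zero, those below are
    assumed to contribute nothing in this degree, and slice i contributes its coefficient r. *)
Lemma coef_contract_slice d c s i r f : size c = d -> size s = d -> (i < B)%N ->
    (forall x t, (i < x < B)%N -> size t = d -> all (fun y => y < B)%N t ->
      f (x :: t) = 0) ->
    (forall x, (x < i)%N ->
      (contract B (geos c s) (fun t => f (x :: t)))`_(r + i - x) = 0) ->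
  (contract B (geos (true :: c) (0%N :: s)) f)`_(r + i) =
  (contract B (geos c s) (fun t => f (i :: t)))`_r.
Proof.
move=> sz_c sz_s iB f_gt f_lt /=; rewrite coef_sum (bigD1 (Ordinal iB)) //=.
rewrite mul1r subn0 coefXnM ltnNge leq_addl /= addnK big1 ?addr0 //.
move=> x; rewrite -val_eqE neq_ltn /= => /orP[xi|ix].
  by rewrite mul1r subn0 coefXnM ltnNge (ltnW (ltn_addl _ xi)) f_lt.
rewrite -/(geos c s) (@eq_contract _ _ _ _ _ (fun=> 0)) => [|t]; last first.
  by rewrite size_geos ?sz_c // sz_s => sz_t t_lt; rewrite f_gt ?ix ?ltn_ord.
by rewrite contract0 mulr0 coef0.
Qed.

Lemma contract_cons_false c s i f : (i < B)%N ->
  contract B (geos (false :: c) (i :: s)) f =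
  contract B (geos c s) (fun t => f (i :: t)).
Proof.
move=> iB /=; rewrite (bigD1 (Ordinal iB)) //= eqxx mul1r big1 ?addr0 // => x.
by rewrite -val_eqE /= eq_sym => /negPf ->; rewrite mul0r.
Qed.

Lemma contract_false s f : all (fun x => x < B)%N s ->
  contract B (geos (nseq (size s) false) s) f = (f s)%:A.
Proof.
elim: s f => [|x s IHs] f // /andP[xB sB].
by rewrite [nseq _ _]/= contract_cons_false // IHs.
Qed.

(* Induction on d: the top slice of f in the first variable satisfies the
   vanishing conditions of the shape obtained by removing one box from the
   shortest column of length > i, and every function of the span for that
   shape is the top slice of a function of the span for lam. *)
Lemma vdm_span_vanishing lam q d f :
    (forall a, lam a.+1 <= lam a)%N -> (lam 0%N <= B)%N ->
    (forall a, (q <= a)%N -> lam a = 0%N) -> (\sum_(a < q) lam a = d)%N ->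
  vanishing lam d f -> vdm_span lam q d f.
Proof.
elim: d lam f => [|d IHd] lam f lamS lam_le lam_q lam_d f_van.
  apply: (@vdm_span_ext _ _ _ (fun s => f [::] * vdm_prod C q [::] (shift [::] s) + 0)).
    apply: vdm_span_lin; last exact: vdm_span0.
    apply: vdm_span_gen => // a aq; apply/esym/eqP; rewrite -leqn0 -lam_d.
    by rewrite (bigD1 (Ordinal aq)) //= leq_addr.
  by case=> // _ _; rewrite /vdm_prod big1 ?addr0 ?mulr1 // => a _; apply: vdm_nil.
have lam_homo : {homo lam : a b / (a <= b)%N >-> (b <= a)%N}.
  exact: homo_leq (@leqnn) (fun _ _ _ ab bc => leq_trans bc ab) lamS.
(* Inner induction on a strict bound [b] for the support in the first variable. *)
suff top b : (b <= B)%N -> forall f, vanishing lam d.+1 f ->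
    (forall x t, (b <= x < B)%N -> size t = d -> all (fun y => y < B)%N t ->
      f (x :: t) = 0) -> vdm_span lam q d.+1 f.
  by apply: (top B) => // x t; lia.
elim: b => [|i IHi] iB {f_van}f f_van f_gt.
  apply: vdm_span_ext (vdm_span0 _ _ _) _ => -[|x t] // [sz_t] /= /andP[xB tB].
  by rewrite f_gt.
(* The first inequality kills the slices below i, which enter in degrees above r, with the first
   position unmarked; the second is the vanishing condition with the first position marked. *)
have slice c s r : size c = d -> size s = d ->
    (\sum_(a < count id c) lam a < r.+1 + count id c)%N ->
    (\sum_(a < (count id c).+1) lam a < r + i + (count id c).+1)%N ->
  (contract B (geos c s) (fun t => f (i :: t)))`_r = 0.
  move=> sz_c sz_s r_gt r_gt'; rewrite -(coef_contract_slice sz_c sz_s) //.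
    by apply: f_van; rewrite /= ?sz_c ?sz_s ?add1n.
  move=> x xi; rewrite -contract_cons_false ?(ltn_trans xi) //.
  apply: f_van; rewrite /= ?sz_c ?sz_s ?add0n //.
  apply: leq_trans r_gt _; rewrite leq_add2r; lia.
(* If i >= lam 0, marking the first position alone shows that slice i is already zero. *)
have [i_lt|i_ge] := ltnP i (lam 0%N); last first.
  apply: IHi => // [|x t]; first exact: ltnW.
  case/andP; rewrite leq_eqVlt => /predU1P[<- _ sz_t t_lt|ix xB]; last first.
    by apply: f_gt; rewrite ix.
  have : (contract B (geos (nseq d false) t) (fun t => f (i :: t)))`_0 = 0.
    apply: slice; rewrite ?size_nseq ?count_nseq ?mul0n ?big_ord0 //.
    by rewrite big_ord_recr big_ord0 add0n addn1.
  by rewrite -sz_t contract_false // coefZ coef1 mulr1.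
have ex_a : exists a, (i < lam a)%N by exists 0%N.
have a_le a : (i < lam a)%N -> (a <= q)%N.
  by move=> ia; rewrite leqNgt; apply: contraTN ia => /ltnW /lam_q ->.
(* Taking the last column longer than i keeps [lam'] nonincreasing. *)
case: (ex_maxnP ex_a a_le) => a0 i_a0 a0_max.
have a0q : (a0 < q)%N by rewrite ltnNge; apply: contraTN i_a0 => /lam_q ->.
pose lam' a := (lam a - (a == a0))%N.
have lamE a : lam a = ((a == a0) + lam' a)%N.
  by rewrite /lam' subnKC //; case: eqP => // ->; apply: leq_trans i_a0.
have lam'S a : (lam' a.+1 <= lam' a)%N.
  rewrite /lam'; have := lamS a; case: (eqVneq a a0) => [->|a_neq]; last by lia.
  have : (lam a0.+1 <= i)%N by rewrite leqNgt; apply/negP => /a0_max; rewrite ltnn.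
  by rewrite gtn_eqF //; lia.
have sum_lam n : (\sum_(a < n) lam a = (a0 < n) + \sum_(a < n) lam' a)%N.
  rewrite (eq_bigr (fun a : 'I_n => (a == a0 :> nat) + lam' a)%N) // big_split /=.
  congr (_ + _)%N; have [a0n|a0n] := ltnP a0 n.
    rewrite (bigD1 (Ordinal a0n)) //= eqxx big1 // => a.
    by rewrite -val_eqE /= => /negPf ->.
  by rewrite big1 // => a _; rewrite ltn_eqF // (leq_trans (ltn_ord a)).
have g_van : vanishing lam' d (fun t => f (i :: t)).
  move=> c s r sz_c sz_s r_gt.
  (* Up to a0 marked positions, [lam] and [lam'] have equal partial sums and the first position
     stays unmarked. Beyond that it is marked, which gains i and costs lam (count id c) <= i. *)
  have [c_le|c_gt] := leqP (count id c) a0.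
    rewrite -contract_cons_false //; apply: f_van; rewrite /= ?sz_c ?sz_s //.
    by rewrite add0n sum_lam [(a0 < _)%N]ltnNge c_le.
  apply: slice => //; rewrite ?big_ord_recr /= sum_lam c_gt; first by lia.
  have : (lam (count id c) <= i)%N.
    by rewrite leqNgt; apply/negP => /a0_max; rewrite leqNgt c_gt.
  by lia.
have g_span : vdm_span lam' q d (fun t => f (i :: t)).
  apply: IHd => //.
  - by apply: leq_trans lam_le; rewrite leq_subr.
  - by move=> a /lam_q; rewrite /lam' => ->.
  by have := sum_lam q; rewrite lam_d a0q => -[].
have i_a0B : (i < lam a0 <= B)%N.
  by rewrite i_a0 (leq_trans _ lam_le) // lam_homo.
have [F [F_span FE]] := vdm_span_lift a0q lamE i_a0B g_span.
(* f - F still satisfies the vanishing conditions, since [F] lies in the span, and its slice i is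
   zero: the inner induction applies. *)
apply: (@vdm_span_ext _ _ _ (fun s => 1 * F s + (-1 * F s + f s))).
  apply: vdm_span_lin => //; apply: IHi; first exact: ltnW.
    by apply: vanishing_lin => //; apply: vanishing_vdm_span F_span.
  move=> x t /andP[]; rewrite leq_eqVlt => ix xB sz_t t_lt.
  have [Fi F0] := FE t sz_t t_lt.
  case/predU1P: ix => [<-|ix]; first by rewrite Fi mulN1r addNr.
  by rewrite F0 // f_gt ?ix // mulr0 addr0.
by move=> s _ _; rewrite mul1r mulN1r addNKr.
Qed.

End Harmonic.

(** * Differential operators on polynomials *)

Local Notation "1" := (monalg.one : {cmonom _}) : monom_scope.
Local Notation "x * y" := (monalg.mul x y) : monom_scope.

Lemma twisted_derivation_lin (C : comNzRingType) (A : comAlgType C) (D : A -> A)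
    (u : A) (k c : C) (P Q : A) :
    (forall c P Q, D (c *: P + Q) = c *: D P + D Q) ->
    D (u * P) = k *: P + u * D P -> D (u * Q) = k *: Q + u * D Q ->
  D (u * (c *: P + Q)) = k *: (c *: P + Q) + u * D (c *: P + Q).
Proof.
move=> D_lin DP DQ; rewrite mulrDr -scalerAr !D_lin DP DQ !(mulrDr, scalerDr).
by rewrite !scalerA -scalerAr [c * k]mulrC addrACA.
Qed.

Section MonomialAlgebra.
Variables (C : comNzRingType) (I : choiceType).
Local Notation M := {cmonom I}.
Local Notation V := {malg C[M]}.
Local Notation U := (@ucm I).
Implicit Types (v w : I) (m : M) (P Q : V).

Lemma cmonom_ind (ok : pred I) (p : M -> Prop) :
    p 1%M ->
    (forall v m, ok v -> (forall w, m w != 0%N -> ok w) -> p m -> p (U v * m)%M) ->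
  forall m, (forall v, m v != 0%N -> ok v) -> p m.
Proof.
move=> p1 pM m; move: {2}(mdeg m) (erefl (mdeg m)) => n.
elim: n m => [|n IHn] m mn m_ok; first by rewrite (mdeg_eq0I mn).
have [v m_v] : exists v, m v != 0%N.
  have /fset0Pn[v v_m] : finsupp m != fset0.
    by apply/eqP => m0; move: mn; rewrite mdegE m0 big_seq_fset0.
  by exists v; rewrite cmE_neq0.
have mE : m = (U v * divcm m (U v))%M.
  apply/eqP/cmP => w; rewrite cmM divcmE cmU.
  by case: eqP => [<-|_]; [rewrite subnKC ?lt0n | rewrite subn0].
have m'_ok w : divcm m (U v) w != 0%N -> ok w.
  move=> w0; apply: m_ok; rewrite mE cmM -lt0n.
  by apply: leq_trans (leq_addl _ _); rewrite lt0n.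
rewrite mE; apply: pM => //; first exact: m_ok.
by apply: IHn => //; move: mn; rewrite {1}mE mdegM mdegU => -[].
Qed.

Lemma malg_monom_ind (p : V -> Prop) P :
    p 0 -> (forall (c : C) P Q, p P -> p Q -> p (c *: P + Q)) ->
    (forall m, m \in msupp P -> p << m >>) ->
  p P.
Proof.
move=> p0 plin pm; rewrite (monalgE P) big_seq.
elim/big_rec: _ => // m Q mP pQ.
have -> : << P@_m *g m >> = P@_m *: << m >> :> V.
  by apply/malgP => m'; rewrite [RHS]mcoeffZ [LHS]mcoeffU mcoeffU1 mulr_natr.
by apply: plin => //; apply: pm.
Qed.

Lemma monalgUM m1 m2 : << m1 >> * << m2 >> = << (m1 * m2)%M >> :> V.
Proof. by rewrite malgM_def fgmulUU mulr1. Qed.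

Lemma malg_var_ind (ok : pred I) (p : V -> Prop) :
    p 0 -> (forall (c : C) P Q, p P -> p Q -> p (c *: P + Q)) ->
    p 1 -> (forall v P, ok v -> p P -> p (<< U v >> * P)) ->
  forall P, (forall m, m \in msupp P -> forall v, m v != 0%N -> ok v) -> p P.
Proof.
move=> p0 plin p1 pvar P P_ok; apply: (malg_monom_ind p0 plin) => m /P_ok.
apply: (@cmonom_ind ok (fun m => p << m >>) p1) => v m' ok_v _ pm.
by rewrite -monalgUM; apply: pvar.
Qed.

Section Substitution.
Variable A : comAlgType C.

Definition subst_monom (s : I -> A) m : A := \prod_(v <- finsupp m) s v ^+ m v.

Lemma subst_monomE s m (D : {fset I}) : (finsupp m `<=` D)%fset ->
  subst_monom s m = \prod_(v <- D) s v ^+ m v.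
Proof.
move=> mD; rewrite /subst_monom (big_fset_incl _ mD) // => v _.
by rewrite -cmE_eq0 => /eqP ->; rewrite expr0.
Qed.

Lemma subst_monom_morph s : mmorphism (subst_monom s).
Proof.
split=> [m1 m2|]; last by rewrite /subst_monom mdom1 big_seq_fset0.
rewrite {1}/subst_monom mdomD (subst_monomE s (fsubsetUl _ (finsupp m2))).
rewrite (subst_monomE s (fsubsetUr (finsupp m1) _)) -big_split /=.
by apply: eq_bigr => v _; rewrite cmM exprD.
Qed.

HB.instance Definition _ s :=
  isMultiplicative.Build M A (subst_monom s) (subst_monom_morph s).

HB.instance Definition _ s := GRing.RMorphism.copy (@subst C I A s)
  (mmap (in_alg A) (subst_monom s)).

Lemma substZ (s : I -> A) c P : subst s (c *: P) = c *: subst s P.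
Proof.
rewrite -[c *: subst s P]mulr_algl.
exact: (@mmapZ _ _ _ (in_alg A) (subst_monom s)).
Qed.

Lemma substD (s : I -> A) P Q : subst s (P + Q) = subst s P + subst s Q.
Proof. exact: (rmorphD (subst s)). Qed.

Lemma subst1 (s : I -> A) : subst s 1 = 1.
Proof. exact: (rmorph1 (subst s)). Qed.

Lemma substM (s : I -> A) P Q : subst s (P * Q) = subst s P * subst s Q.
Proof. exact: (rmorphM (subst s)). Qed.

Lemma subst_var (s : I -> A) v : subst s << U v >> = s v.
Proof.
transitivity ((1 : C)%:A * subst_monom s (U v)).
  exact: (mmapU (f := in_alg A) (h := subst_monom s)).
by rewrite scale1r mul1r /subst_monom mdomU big_seq_fset1 cmUU expr1.
Qed.

End Substitution.

(** On a monomial free of [w] the division truncates, but the coefficient is then 0. *)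
Definition pderiv w P : V :=
  mmap (@mkmalgU M C 1%M) (fun m => << (m w)%:R *g divcm m (U w) >>) P.

Lemma pderivU w m : pderiv w << m >> = << (m w)%:R *g divcm m (U w) >>.
Proof. by rewrite /pderiv mmapU mul1r. Qed.

Lemma mcoeff_pderiv w P m : (pderiv w P)@_m = P@_(U w * m)%M *+ (m w).+1.
Proof.
rewrite /pderiv mmapE raddf_sum /=.
under eq_bigr => m' _ do rewrite mul_malgC mcoeffZ mcoeffU.
have E m' : m' != (U w * m)%M ->
    P@_m' * ((m' w)%:R *+ (divcm m' (U w) == m)) = 0.
  move=> m'_neq; have [-> | m'w] := eqVneq (m' w) 0%N; first by rewrite mul0rn mulr0.
  case: eqP => [mE|_]; last by rewrite mulr0.
  case/eqP: m'_neq; apply/eqP/cmP => v; rewrite cmM -mE divcmE cmU.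
  by case: eqP => [<-|_]; [rewrite subnKC ?lt0n | rewrite subn0].
case: (msuppP P (U w * m)%M) => [mP|mP]; last first.
  rewrite mul0rn big_seq big1 // => m' m'P; rewrite E //.
  by apply: contraNneq mP => <-.
rewrite (big_fsetD1 (U w * m)%M) //= big_seq big1 => [|m']; last first.
  by rewrite in_fsetD1 => /andP[m'_neq _]; rewrite E.
rewrite addr0 cmM cmUU add1n.
suff -> : divcm (U w * m)%M (U w) == m by rewrite mulr1n mulr_natr.
by apply/cmP => v; rewrite divcmE cmM addKn.
Qed.

Lemma pderiv_lin w c P Q : pderiv w (c *: P + Q) = c *: pderiv w P + pderiv w Q.
Proof.
apply/malgP => m; rewrite [RHS]mcoeffD [X in _ = X + _]mcoeffZ.
rewrite [LHS]mcoeff_pderiv [X in _ = _ + X]mcoeff_pderiv.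
rewrite [X in _ = _ * X + _]mcoeff_pderiv.
by rewrite [X in X *+ _]mcoeffD mcoeffZ mulrnDl mulrnAr.
Qed.

Lemma pderiv0 w : pderiv w 0 = 0.
Proof. by apply/malgP => m; rewrite mcoeff_pderiv !mcoeff0 mul0rn. Qed.

Lemma pderiv1 w : pderiv w 1 = 0.
Proof.
apply/malgP => m; rewrite mcoeff_pderiv mcoeff0 mcoeff1 cmM_eq1 cm1_eq1.
by rewrite mul0rn.
Qed.

Lemma pderiv_varM w v P :
  pderiv w (<< U v >> * P) = (v == w)%:R *: P + << U v >> * pderiv w P.
Proof.
apply: (@malg_monom_ind (fun P => pderiv w (<< U v >> * P) =
  (v == w)%:R *: P + << U v >> * pderiv w P)) => [|c P1 P2 IH1 IH2|m _].
- by rewrite !(mulr0, pderiv0, scaler0, addr0).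
- exact: (@twisted_derivation_lin C V (pderiv w) << U v >> (v == w)%:R c P1 P2 (@pderiv_lin w) IH1 IH2).
rewrite [X in pderiv w X = _]monalgUM [LHS]pderivU [X in _ = _ + _ * X]pderivU.
rewrite [X in _ = _ + X]malgM_def [X in _ = _ + X]fgmulUU mul1r.
apply/malgP => m'; rewrite [RHS]mcoeffD [X in _ = X + _]mcoeffZ.
rewrite [LHS]mcoeffU [X in _ = _ + X]mcoeffU [X in _ = _ * X + _]mcoeffU cmM cmU.
have [<-|vw] := eqVneq v w.
  have -> : divcm (U v * m)%M (U v) = m.
    by apply/eqP/cmP => u; rewrite divcmE cmM addKn.
  have [->|mv] := eqVneq (m v) 0%N; first by rewrite mul0rn addr0 mul1r.
  have -> : (U v * divcm m (U v))%M = m.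
    apply/eqP/cmP => u; rewrite cmM divcmE cmU.
    by case: eqP => [<-|_]; [rewrite subnKC ?lt0n | rewrite subn0].
  by rewrite mul1r -mulrnDl natrD.
rewrite mul0r add0r add0n; congr (_ *+ (_ == _)).
apply/eqP/cmP => u; rewrite divcmE !cmM divcmE !cmU.
by case: (eqVneq w u) => [<-|_]; [rewrite (negPf vw) | rewrite !subn0].
Qed.

End MonomialAlgebra.

(** * Polarization *)

Fixpoint words (T : Type) (r : seq T) (d : nat) : seq (seq T) :=
  if d is d'.+1 then [seq i :: w | i <- r, w <- words r d'] else [:: [::]].

Lemma size_words (T : eqType) (r : seq T) d w : w \in words r d -> size w = d.
Proof.
elim: d w => [|d IHd] w; first by rewrite inE => /eqP ->.
by case/allpairsPdep => i [w' [_ /IHd <- ->]].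
Qed.

Lemma mem_words (T : eqType) (r : seq T) d w :
  size w = d -> all (mem r) w -> w \in words r d.
Proof.
elim: d w => [|d IHd] [|i w] //= [sz_w] /andP[ri rw].
by apply: allpairs_f => //; apply: IHd.
Qed.

(** The summands are the parts of the partition (B, ..., B, s) of d. *)
Lemma sum_minn_blocks (B d n : nat) :
  (\sum_(a < n) minn B (d - a * B) = minn (n * B) d)%N.
Proof.
elim: n => [|n IHn]; first by rewrite big_ord0 min0n.
by rewrite big_ord_recr /= IHn mulSn; lia.
Qed.

Section Polarization.
Variables (C : numFieldType) (I : finType) (A : comAlgType C) (B : nat).
(* X i x stands for X_i^(x) / x!, D i x for the derivation with respect to it,
   eps for the constant term, ok for "of order < B" and tau z for the action of
   1 / (1 - z T). *)
Variables (X : I -> nat -> A) (D : I -> nat -> A -> A) (eps : A -> C).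
Variables (ok : A -> Prop) (homog : nat -> A -> Prop) (tau : C -> A -> A).

Hypothesis D_lin : forall i x (c : C) P Q, D i x (c *: P + Q) = c *: D i x P + D i x Q.
Hypothesis D_1 : forall i x, D i x 1 = 0.
Hypothesis D_varM : forall i x j y P,
  D i x (X j y * P) = ((j == i) && (y == x))%:R *: P + X j y * D i x P.
Hypothesis eps_lin : forall (c : C) P Q, eps (c *: P + Q) = c * eps P + eps Q.
Hypothesis eps_varM : forall i x P, eps (X i x * P) = 0.
Hypothesis ok_ind : forall p : A -> Prop,
  p 0 -> (forall (c : C) P Q, p P -> p Q -> p (c *: P + Q)) -> p 1 ->
  (forall i x P, (x < B)%N -> p P -> p (X i x * P)) -> forall P, ok P -> p P.
Hypothesis ok_D : forall i x P, ok P -> ok (D i x P).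
Hypothesis homog_D : forall d i x P, homog d.+1 P -> homog d (D i x P).
Hypothesis homog0 : forall P, homog 0 P -> P = (eps P)%:A.
Hypothesis euler : forall d P, ok P -> homog d P ->
  d%:R *: P = \sum_i \sum_(x < B) X i x * D i x P.
Hypothesis tau_lin : forall z (c : C) P Q,
  tau z (c *: P + Q) = c *: tau z P + tau z Q.
Hypothesis tau_1 : forall z, tau z 1 = 1.
Hypothesis tauM : forall z P Q, tau z (P * Q) = tau z P * tau z Q.
Hypothesis tau_var : forall z i x,
  tau z (X i x) = \sum_(y < x.+1) z ^+ (x - y) *: X i y.

Lemma D_0 i x : D i x 0 = 0.
Proof. by have := D_lin i x (-1) 0 0; rewrite scaler0 addr0 scaleN1r addNr. Qed.

Lemma D_sum i x (J : finType) (c : J -> C) (P : J -> A) :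
  D i x (\sum_j c j *: P j) = \sum_j c j *: D i x (P j).
Proof.
elim/big_rec2: _ => [|j u v _ <-]; first exact: D_0.
by rewrite D_lin.
Qed.

Lemma eps_0 : eps 0 = 0.
Proof. by have := eps_lin (-1) 0 0; rewrite scaler0 addr0 mulN1r addNr. Qed.

Lemma eps_sum (J : finType) (c : J -> C) (P : J -> A) :
  eps (\sum_j c j *: P j) = \sum_j c j * eps (P j).
Proof.
elim/big_rec2: _ => [|j u v _ <-]; first exact: eps_0.
by rewrite eps_lin.
Qed.

Lemma tau_0 z : tau z 0 = 0.
Proof. by have := tau_lin z (-1) 0 0; rewrite scaler0 addr0 scaleN1r addNr. Qed.

(** Chain rule: X_i^[x] occurs in [tau z (X i y)] with coefficient z^(y - x) when x <= y. *)
Lemma D_tau z i x P : ok P ->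
  D i x (tau z P) =
  \sum_(y < B) ((x <= y)%N%:R * z ^+ (y - x)) *: tau z (D i y P).
Proof.
move: P; apply: ok_ind => [|c P Q DP DQ||j b P bB DP].
- rewrite tau_0 D_0 big1 // => y _.
  by rewrite D_0 tau_0 scaler0.
- rewrite tau_lin D_lin DP DQ scaler_sumr -big_split; apply: eq_bigr => y _ /=.
  by rewrite D_lin tau_lin scalerDr !scalerA mulrC.
- rewrite tau_1 D_1 big1 // => y _.
  by rewrite D_1 tau_0 scaler0.
transitivity (\sum_(c < b.+1) z ^+ (b - c) *:
    (((j == i) && (c == x :> nat))%:R *: tau z P) + tau z (X j b) * D i x (tau z P)).
  rewrite tauM {1}tau_var mulr_suml.
  under eq_bigr => c _ do rewrite -scalerAl.
  rewrite D_sum tau_var mulr_suml -big_split; apply: eq_bigr => c _ /=.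
  by rewrite D_varM scalerDr scalerAl.
rewrite DP mulr_sumr.
transitivity (\sum_(y < B) ((x <= y)%N%:R * z ^+ (y - x)) *:
    (((j == i) && (b == y))%:R *: tau z P) +
  \sum_(y < B) tau z (X j b) * (((x <= y)%N%:R * z ^+ (y - x)) *: tau z (D i y P))).
  congr (_ + _); rewrite [RHS](bigD1 (Ordinal bB)) //= eqxx andbT.
  rewrite [X in _ = _ + X]big1 ?addr0 => [|y]; last first.
    by rewrite -val_eqE /= eq_sym => /negPf ->; rewrite andbF scale0r scaler0.
  have [xb|bx] := leqP x b; last first.
    rewrite mul0r scale0r big1 // => c _.
    by rewrite ltn_eqF ?andbF ?scale0r ?scaler0 // (leq_ltn_trans _ bx) // -ltnS.
  have xbS : (x < b.+1)%N by [].
  rewrite (bigD1 (Ordinal xbS)) //= eqxx andbT mul1r big1 ?addr0 // => c.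
  by rewrite -val_eqE /= => /negPf ->; rewrite andbF scale0r scaler0.
rewrite -big_split; apply: eq_bigr => y _ /=.
rewrite D_varM tau_lin tauM scalerDr; congr (_ + _).
by rewrite scalerAr.
Qed.

Lemma eps_varM_sum z i x P : eps (tau z (X i x) * P) = 0.
Proof.
rewrite tau_var mulr_suml.
under eq_bigr => c _ do rewrite -scalerAl.
by rewrite eps_sum big1 // => c _; rewrite eps_varM mulr0.
Qed.

Lemma eps_tau z P : ok P -> eps (tau z P) = eps P.
Proof.
move: P; apply: ok_ind => [|c P Q EP EQ||j b P bB _].
- by rewrite tau_0.
- by rewrite tau_lin !eps_lin EP EQ.
- by rewrite tau_1.
by rewrite tauM eps_varM_sum eps_varM.
Qed.

Fixpoint iterD (w : seq I) (s : seq nat) (P : A) : A :=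
  match w, s with
  | i :: w', x :: s' => iterD w' s' (D i x P)
  | _, _ => P
  end.

Lemma iterD_lin w s (c : C) P Q :
  iterD w s (c *: P + Q) = c *: iterD w s P + iterD w s Q.
Proof. by elim: w s P Q => [|i w IHw] [|x s] P Q //=; rewrite D_lin IHw. Qed.

Lemma iterD_sum w s (J : finType) (c : J -> C) (P : J -> A) :
  iterD w s (\sum_j c j *: P j) = \sum_j c j *: iterD w s (P j).
Proof.
elim/big_rec2: _ => [|j u v _ <-]; last by rewrite iterD_lin.
by have := iterD_lin w s (-1) 0 0; rewrite scaler0 addr0 scaleN1r addNr.
Qed.

Definition polar w P (s : seq nat) : C := eps (iterD w s P).

(** Iterating [D_tau] produces the weights [geo true] at 'X = z, so the action of 1 / (1 - z T)
    becomes the generating polynomial of the h_r. *)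
Lemma polar_tau z w s P : ok P -> size s = size w ->
  polar w (tau z P) s =
  (contract B (geos C (nseq (size w) true) s) (polar w P)).[z].
Proof.
elim: w s P => [|i w IHw] [|x s] P ok_P //=.
  by rewrite /polar /= alg_polyC hornerC eps_tau.
move=> [sz_s]; rewrite /polar /= D_tau // iterD_sum eps_sum horner_sum.
apply: eq_bigr => y _; rewrite hornerM.
have -> : (geo C true x y).[z] = (x <= y)%N%:R * z ^+ (y - x).
  by rewrite /geo hornerM hornerXn -polyC_natr hornerC.
by congr (_ * _); apply: (IHw s (D i y P)) => //; apply: ok_D.
Qed.

(** In characteristic 0 the naturals supply more roots than the degree allows. *)
Lemma horner_const (p : {poly C}) (c : C) : (forall z, p.[z] = c) -> p = c%:P.
Proof.
move=> pc; apply/eqP; rewrite -subr_eq0; apply/negP => /negP q0.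
pose rs : seq C := [seq n%:R | n <- iota 0 (size (p - c%:P)%R)].
have rs_roots : all (root (p - c%:P)) rs.
  by apply/allP => z _; rewrite rootE !hornerE pc subrr.
have rs_uniq : uniq rs by rewrite map_inj_uniq ?iota_uniq // => a b /eqP; rewrite eqr_nat => /eqP.
by have := max_poly_roots q0 rs_roots rs_uniq; rewrite size_map size_iota ltnn.
Qed.

(** With n marked positions the partial sum is the minimum of n B and d. Order < B bounds the degree
    by n (B - 1); invariance bounds it by d - n through [contract_geos_compl]. *)
Lemma vanishing_polar d w P : (0 < B)%N -> ok P -> (forall z, tau z P = P) -> size w = d ->
  vanishing B (fun a => minn B (d - a * B)) d (polar w P).
Proof.
move=> B_gt0 ok_P P_inv sz_w c s r sz_c sz_s r_gt.
rewrite sum_minn_blocks gtn_min in r_gt; case/orP: r_gt => r_gt.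
  apply: contract_geos_count; move: r_gt.
  by rewrite -{1}(prednK B_gt0) mulnS addnC ltn_add2r.
apply: (@contract_geos_compl _ _ d) => // [t k sz_t k_gt0|]; last first.
  by have := count_negb c; rewrite sz_c; lia.
have E z : (contract B (geos C (nseq d true) t) (polar w P)).[z] = polar w P t.
  by rewrite -{1}sz_w -polar_tau ?P_inv ?sz_w.
by rewrite (horner_const E) coefC gtn_eqF.
Qed.

(** Euler's identity iterated d times; the scalars d, d - 1, ... multiply to d!. *)
Lemma polar_restitution d P : ok P -> homog d P ->
  d`!%:R *: P =
  \sum_(w <- words (index_enum I) d) contract B [seq X i | i <- w] (polar w P).
Proof.
elim: d P => [|d IHd] P ok_P P_d.
  by rewrite scale1r big_seq1 /= -homog0.
rewrite factS mulnC natrM -scalerA (euler ok_P P_d) /= big_allpairs_dep /=.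
rewrite scaler_sumr; apply: eq_bigr => i _.
rewrite scaler_sumr exchange_big; apply: eq_bigr => x _ /=.
by rewrite scalerAr IHd ?mulr_sumr; [|apply: ok_D|apply: homog_D].
Qed.

Definition wronskian (w : seq I) (m : seq nat) : A :=
  contract B [seq X i | i <- w] (fun s => vdm C (shift m s)).

(** [S] stands for an arbitrary subalgebra containing the generalized Wronskians; membership in
    every such [S] expresses generation. *)
Variable S : A -> Prop.
Hypothesis S_lin : forall (c : C) P Q, S P -> S Q -> S (c *: P + Q).
Hypothesis SM : forall P Q, S P -> S Q -> S (P * Q).
Hypothesis S1 : S 1.
Hypothesis S_wronskian : forall w m, size m = size w -> (size w <= B)%N ->
  all (fun x => x < B)%N m -> S (wronskian w m).

Lemma S_0 : S 0.
Proof. by have := S_lin (-1) S1 S1; rewrite scaleN1r addNr. Qed.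

(** A Vandermonde product contracts to a product of Wronskians, one for each block, of size at most
    B. *)
Lemma S_contract lam q d w f : (forall a, (a < q)%N -> lam a <= B)%N ->
  size w = d -> vdm_span B lam q d f -> S (contract B [seq X i | i <- w] f).
Proof.
move=> lam_le sz_w; elim=> {f}.
- move=> kappa m sz_k sz_m k_lt m_lt k_lam.
  pose h a t := vdm C (shift (mask (colour a kappa) m) t).
  rewrite (@eq_contract _ _ _ _ _
    (fun t => \prod_(a < q) h a (mask (colour a kappa) t))); last first.
    rewrite size_map => t sz_t _; apply: eq_bigr => a _.
    by rewrite /h mask_shift // sz_m sz_t.
  rewrite contract_prod_mask ?size_map ?sz_w //.
  elim/big_rec: _ => // a P _ SP; apply: SM => //.
  rewrite -map_mask; apply: S_wronskian.
  + by rewrite !size_mask_colour ?sz_w ?sz_m.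
  + by rewrite size_mask_colour ?sz_w // k_lam // lam_le.
  by rewrite all_mask.
- by rewrite contract0; apply: S_0.
- by move=> c f g _ Sf _ Sg; rewrite contract_lin; apply: S_lin.
move=> f g _ Sf fg; rewrite -(@eq_contract _ _ _ _ f) // => s.
by rewrite size_map sz_w; apply: fg.
Qed.

Lemma S_invariant d P : (0 < B)%N -> ok P -> homog d P -> (forall z, tau z P = P) ->
  S P.
Proof.
move=> B_gt0 ok_P P_d P_inv.
have d_neq0 : d`!%:R != 0 :> C by rewrite pnatr_eq0 -lt0n fact_gt0.
rewrite -[P]scale1r -(mulVf d_neq0) -scalerA (polar_restitution ok_P P_d).
rewrite -[_ *: _]addr0; apply: S_lin; last exact: S_0.
rewrite big_seq; elim/big_rec: _ => [|w Q /size_words sz_w SQ]; first exact: S_0.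
rewrite -[contract _ _ _]scale1r; apply: S_lin => //.
(* The partition (B, ..., B, s) of d; [d] parts suffice because B > 0. *)
apply: (@S_contract (fun a => minn B (d - a * B)) d d) => // [a _|].
  exact: geq_minl.
apply: vdm_span_vanishing (vanishing_polar _ _ _ _) => //.
- by move=> a; rewrite mulSn; lia.
- exact: geq_minl.
- by move=> a da; nia.
by rewrite sum_minn_blocks; nia.
Qed.

End Polarization.

(** * Derivations, Euler identity and group action on differential polynomials *)

Lemma scaled_varM (C : comNzRingType) (A : comAlgType C) (p : A -> A)
    (a b k : C) (u P : A) :
    (forall (c : C) P Q, p (c *: P + Q) = c *: p P + p Q) -> p 0 = 0 ->
    p (u * P) = k *: P + u * p P ->
  a *: p (b *: u * P) = (a * b * k) *: P + b *: u * (a *: p P).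
Proof.
move=> p_lin p0 pu; rewrite -scalerAl -[b *: _]addr0 p_lin p0 addr0 pu.
rewrite !scalerDr !scalerA -scalerAl -scalerAr scalerA.
by rewrite [b * a]mulrC.
Qed.

Section EulerOperator.
Variables (C : comNzRingType) (A : comAlgType C) (I : finType) (B : nat).
Variables (u : I -> nat -> A) (p : I -> nat -> A -> A).
Hypothesis p_lin :
  forall i x (c : C) P Q, p i x (c *: P + Q) = c *: p i x P + p i x Q.

Definition euler_op P := \sum_i \sum_(x < B) u i x * p i x P.

Lemma euler_op_lin (c : C) P Q :
  euler_op (c *: P + Q) = c *: euler_op P + euler_op Q.
Proof.
rewrite /euler_op scaler_sumr -big_split; apply: eq_bigr => i _ /=.
rewrite scaler_sumr -big_split; apply: eq_bigr => x _ /=.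
by rewrite p_lin mulrDr scalerAr.
Qed.

Lemma euler_op_varM j y P : (y < B)%N ->
    (forall i x, p i x (u j y * P) =
       ((j, y) == (i, x))%:R *: P + u j y * p i x P) ->
  euler_op (u j y * P) = u j y * P + u j y * euler_op P.
Proof.
move=> yB pE; rewrite /euler_op mulr_sumr.
under eq_bigr => i _.
  under eq_bigr => x _ do rewrite pE mulrDr mulrCA.
  rewrite big_split -mulr_sumr; over.
rewrite big_split /=; congr (_ + _).
rewrite (bigD1 j) //= (bigD1 (Ordinal yB)) //= eqxx scale1r !big1 ?addr0 //.
  move=> i ij; rewrite big1 // => x _.
  by rewrite xpair_eqE eq_sym (negPf ij) scale0r mulr0.
move=> x; rewrite -val_eqE /= eq_sym xpair_eqE eqxx => /negPf ->.
by rewrite scale0r mulr0.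
Qed.

Lemma euler_op_eq0 P : (forall i x, p i x P = 0) -> euler_op P = 0.
Proof.
by move=> p0; rewrite /euler_op big1 // => i _; rewrite big1 // => x _; rewrite p0 mulr0.
Qed.

End EulerOperator.

Section Concrete.
Variables (C : numFieldType) (N : nat).
Local Notation V := (dpoly C N).
Local Notation I := 'I_N.+1.
Implicit Types (P Q : V).

(* [X_i^(x) / x!], the coefficient of T^x in the generic power series X_i(T). *)
Definition dvarn (i : I) (x : nat) : V := (x`!%:R)^-1 *: dvar C i x.

Definition pderivn (i : I) (x : nat) P : V := x`!%:R *: pderiv (i, x) P.

Lemma fact_neq0 x : x`!%:R != 0 :> C.
Proof. by rewrite pnatr_eq0 -lt0n fact_gt0. Qed.

Lemma dvar_dvarn i x : dvar C i x = x`!%:R *: dvarn i x.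
Proof. by rewrite /dvarn scalerA mulfV ?fact_neq0 // scale1r. Qed.

Lemma pderivn_lin i x (c : C) P Q :
  pderivn i x (c *: P + Q) = c *: pderivn i x P + pderivn i x Q.
Proof.
rewrite /pderivn pderiv_lin; move: (pderiv _ P) (pderiv _ Q) => P' Q'.
by rewrite scalerDr !scalerA mulrC.
Qed.

Lemma pderivn1 i x : pderivn i x 1 = 0.
Proof. by rewrite /pderivn pderiv1 scaler0. Qed.

Lemma pderivn_varM i x j y P : pderivn i x (dvarn j y * P) =
  ((j == i) && (y == x))%:R *: P + dvarn j y * pderivn i x P.
Proof.
have E : ((j == i) && (y == x))%:R =
    x`!%:R * (y`!%:R)^-1 * ((j, y) == (i, x))%:R :> C.
  rewrite xpair_eqE; case: (j == i); case: eqP => [->|_]; rewrite ?mulr0 //.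
  by rewrite mulr1 mulfV ?fact_neq0.
rewrite [X in X *: _]E.
exact: (@scaled_varM C V (pderiv (i, x)) x`!%:R (y`!%:R)^-1 _ (dvar C j y) P
  (@pderiv_lin _ _ (i, x)) (@pderiv0 C _ (i, x)) (pderiv_varM (i, x) (j, y) P)).
Qed.

Lemma mcoeff1_lin (c : C) P Q :
  (c *: P + Q)@_(monalg.one) = c * P@_(monalg.one) + Q@_(monalg.one).
Proof. by rewrite mcoeffD mcoeffZ. Qed.

Lemma mcoeff1_varM i x P : (dvarn i x * P)@_(monalg.one) = 0.
Proof.
rewrite (mcoeff1g_is_multiplicative _ _).1 /dvarn mcoeffZ mcoeffU cm1_eq1.
by rewrite mulr0 mul0r.
Qed.

Lemma Vord_ind k (p : V -> Prop) :
    p 0 -> (forall (c : C) P Q, p P -> p Q -> p (c *: P + Q)) -> p 1 ->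
    (forall i x P, (x < k.+1)%N -> p P -> p (dvarn i x * P)) ->
  forall P, Vord k P -> p P.
Proof.
move=> p0 plin p1 pX P P_ord.
apply: (@malg_var_ind C _ (fun v => v.2 < k.+1)%N p p0 plin p1) => [[i x] Q xk pQ|].
  have -> : << ucm (i, x) >> * Q = x`!%:R *: (dvarn i x * Q) + 0 :> V.
    by rewrite addr0 scalerAl -dvar_dvarn.
  by apply: plin p0; apply: pX.
by move=> m mP [i x]; apply: P_ord.
Qed.

Lemma msupp_pderivn i x P m : m \in msupp (pderivn i x P) ->
  monalg.mul (ucm (i, x)) m \in msupp P.
Proof.
rewrite -!mcoeff_neq0 /pderivn mcoeffZ; apply: contra_neq => P0.
by rewrite mcoeff_pderiv P0 mul0rn mulr0.
Qed.

Lemma Vord_pderivn k i x P : Vord k P -> Vord k (pderivn i x P).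
Proof.
move=> P_ord m /msupp_pderivn /P_ord m_ord j y m_jy; apply: (m_ord j).
by rewrite cmM addn_eq0 negb_and m_jy orbT.
Qed.

Lemma Vdeg_pderivn d i x P : Vdeg d.+1 P -> Vdeg d (pderivn i x P).
Proof. by move=> P_deg m /msupp_pderivn /P_deg; rewrite mdegM mdegU => -[]. Qed.

Lemma Vdeg0E P : Vdeg 0 P -> P = (P@_(monalg.one))%:A.
Proof.
move=> P0; apply/malgP => m; rewrite mcoeffZ mcoeff1.
have [->|m1] := eqVneq m (monalg.one); first by rewrite mulr1.
rewrite mulr0; apply: mcoeff_outdom; apply/negP => /P0 /eqP.
by rewrite mdeg_eq0 (negPf m1).
Qed.

Lemma dvarn_pderivn i x P : dvarn i x * pderivn i x P = dvar C i x * pderiv (i, x) P.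
Proof.
rewrite /dvarn /pderivn; move: (dvar _ _ _) (pderiv _ _) => u v.
by rewrite -scalerAl -scalerAr scalerA mulVf ?fact_neq0 // scale1r.
Qed.

Lemma euler_Vdeg k d P : Vord k P -> Vdeg d P ->
  d%:R *: P = \sum_i \sum_(x < k.+1) dvarn i x * pderivn i x P.
Proof.
move=> P_ord P_deg.
pose E := @euler_op C V I k.+1 (@dvar C N) (fun i x => pderiv (i, x)).
transitivity (E P); last first.
  by apply: eq_bigr => i _; apply: eq_bigr => x _; rewrite dvarn_pderivn.
have E_lin := @euler_op_lin C V I k.+1 (@dvar C N) (fun i x => pderiv (i, x))
  (fun i x => pderiv_lin (i, x)).
have E_varM j y := @euler_op_varM C V I k.+1 (@dvar C N) (fun i x => pderiv (i, x)) j y.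
have E_eq0 := @euler_op_eq0 C V I k.+1 (@dvar C N) (fun i x => pderiv (i, x)).
rewrite -/E in E_lin E_varM E_eq0.
have {E_eq0} [E0 E1] : E 0 = 0 /\ E 1 = 0.
  by split; apply: E_eq0 => i x; [exact: pderiv0|exact: pderiv1].
(* From here on [E] is known only through linearity, the product rule and its values at 0 and 1. *)
move: (E) E0 E1 E_lin E_varM => {}E E0 E1 E_lin E_varM.
apply: (@malg_monom_ind _ _ (fun Q => d%:R *: Q = E Q)).
- by rewrite scaler0 E0.
- by move=> c Q1 Q2 EQ1 EQ2; rewrite E_lin -EQ1 -EQ2 scalerDr !scalerA mulrC.
move=> m mP; rewrite -(P_deg _ mP).
apply: (@cmonom_ind _ (fun v => v.2 <= k)%N
  (fun m => (mdeg m)%:R *: << m >> = E << m >>)); last first.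
  by move=> [i x]; apply: P_ord mP _ _.
- move=> [i x] m' xk _ IH; rewrite mdegM mdegU -monalgUM.
  rewrite E_varM //; last by move=> j y; apply: pderiv_varM.
  rewrite -IH natrD scalerDl scale1r.
  by rewrite scalerAr.
by rewrite mdeg1 scale0r E1.
Qed.

Lemma iter_fps_deriv (a : fps C) s n :
  iter s (@fps_deriv C) a n = ((n + s) ^_ s)%:R * a (n + s)%N.
Proof.
elim: s n => [|s IHs] n; first by rewrite addn0 ffactn0 mul1r.
rewrite iterS /fps_deriv IHs mulrA -natrM addSnnS ffactnSr mulnC.
by rewrite -addSnnS addnK.
Qed.

Lemma fps_act_lin (a : fps C) (c : C) P Q :
  fps_act a (c *: P + Q) = c *: fps_act a P + fps_act a Q.
Proof. by rewrite /fps_act substD substZ. Qed.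

Lemma fps_act1 (a : fps C) : fps_act a (1 : V) = 1.
Proof. by exact: subst1. Qed.

Lemma fps_actM (a : fps C) P Q : fps_act a (P * Q) = fps_act a P * fps_act a Q.
Proof. by exact: substM. Qed.

(** Dividing by factorials absorbs the binomial coefficients: the substitution becomes
    multiplication of X_i(T) by the series [a]. *)
Lemma fps_act_dvarn (a : fps C) i x :
  fps_act a (dvarn i x) = \sum_(y < x.+1) a (x - y)%N *: dvarn i y.
Proof.
rewrite /dvarn /fps_act substZ subst_var /= scaler_sumr.
apply: eq_bigr => y _; rewrite [LHS]scalerA [RHS]scalerA.
apply: (congr1 (fun t => t *: dvar C i y)).
rewrite /fps_at0 iter_fps_deriv add0n ffactnn.
have yx : (y <= x)%N by rewrite -ltnS.
apply: (mulfI (fact_neq0 x)); rewrite [LHS]mulrA.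
rewrite mulfV ?fact_neq0 // mul1r mulrA -natrM.
rewrite -[in RHS](bin_fact yx) mulnCA [in RHS]natrM [a _ * _]mulrC mulrACA.
by rewrite mulfV ?fact_neq0 // mul1r.
Qed.

End Concrete.

(** * Generalized Wronskians *)

Section WronskianHomogeneity.
Variables (C : comNzRingType) (I : Type) (A : comAlgType C) (B : nat).
Variable X : I -> nat -> A.

Definition wronskian_mx n (w : seq I) (m : seq nat) : 'M[A]_n :=
  \matrix_(a < n, b < n)
    if (nth 0 m a <= b)%N then nth (fun=> 0) [seq X i | i <- w] a (b - nth 0 m a)%N
    else 0.

Lemma wronskianE n w m : size w = n -> size m = n -> (n <= B)%N ->
  contract B [seq X i | i <- w] (fun s => vdm C (shift m s)) =
  \det (wronskian_mx n w m).
Proof.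
move=> sz_w sz_m nB; rewrite (contract_vdm _ (n := n)) ?size_map //.
congr (\det _); apply/matrixP => a b; rewrite !mxE.
set u := nth _ _ _; set x := nth _ _ _.
have [xb|bx] := leqP x b; last first.
  by rewrite big1 // => y _; case: eqP => [?|_]; [lia | rewrite mulr0].
have bxB : (b - x < B)%N by have := ltn_ord b; lia.
rewrite (bigD1 (Ordinal bxB)) //= subnKC // eqxx mulr1 big1 ?addr0 // => y.
rewrite -val_eqE /= => /eqP y_neq.
by case: eqP => [?|_]; [lia | rewrite mulr0].
Qed.

(* Multiplying the generic series by the series a acts on the matrix of a
   generalized Wronskian by a triangular Toeplitz matrix. *)
Lemma wronskian_mx_act n (tau : {rmorphism A -> A}) (a : nat -> C) w m :
    (forall i x, tau (X i x) = \sum_(y < x.+1) a (x - y)%N *: X i y) ->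
    size w = n ->
  tau (\det (wronskian_mx n w m)) = a 0%N ^+ n *: \det (wronskian_mx n w m).
Proof.
move=> tauX sz_w; pose T : 'M[A]_n :=
  \matrix_(b, c) if (c <= b)%N then (a (b - c)%N)%:A else 0.
have -> : tau (\det (wronskian_mx n w m)) = \det (wronskian_mx n w m *m T^T).
  rewrite -det_map_mx; congr (\det _); apply/matrixP => p b; rewrite !mxE.
  under eq_bigr => c _ do rewrite !mxE.
  set x := nth 0%N m p.
  have [i ->] : exists i, nth (fun=> 0) [seq X i | i <- w] p = X i.
    have pw : (p < size w)%N by rewrite sz_w.
    by case: w {sz_w} pw => // i w pw; exists (nth i (i :: w) p); rewrite (nth_map i).
  (* Only x <= c <= b contribute; [F] lives on all naturals so that the sum can be cut at x and b +
     1. *)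
  pose F c := (if (x <= c)%N then X i (c - x)%N else 0) *
    (if (c <= b)%N then (a (b - c)%N)%:A else 0).
  rewrite -(big_mkord xpredT F); have [xb|bx] := leqP x b; last first.
    rewrite raddf0 big1 // => c _; rewrite /F.
    case: leqP => [xc|_]; last by rewrite mul0r.
    by rewrite leqNgt (leq_trans bx xc) mulr0.
  have bn := ltn_ord b.
  rewrite (big_cat_nat (n := x)) ?(leq_trans xb (ltnW bn)) //=.
  rewrite (big_cat_nat (n := b.+1) (m := x)) ?(leq_trans xb) //=.
  rewrite big_nat big1 => [|c /andP[_ cx]]; last first.
    by rewrite /F leqNgt cx mul0r.
  rewrite [X in _ = _ + (_ + X)]big_nat [X in _ = _ + (_ + X)]big1 => [|c /andP[bc _]]; last first.
    by rewrite /F [(c <= b)%N]leqNgt bc mulr0.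
  rewrite add0r addr0 -{2}[x]add0n big_addn big_mkord tauX subSn //.
  apply: eq_bigr => y _; have yb : (y + x <= b)%N by have := ltn_ord y; lia.
  rewrite /F leq_addl addnK yb mulr_algr.
  by congr (a _ *: _); lia.
rewrite det_mulmx det_tr -mulr_algl mulrC; congr (_ * _).
rewrite det_trig; last first.
  by apply/is_trig_mxP => b c bc; rewrite mxE leqNgt bc.
rewrite (eq_bigr (fun=> (a 0%N)%:A)) => [|b _]; last by rewrite mxE leqnn subnn.
by rewrite prodr_const card_ord -(rmorphXn (in_alg A)).
Qed.

End WronskianHomogeneity.

(** Serves for the degree, with [S] equal to [Vdeg], and for the order, with [S] constant in d. *)
Lemma graded_det (C : comNzRingType) (A : comAlgType C) (S : nat -> A -> Prop) n
    (M : 'M[A]_n) :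
    (forall d, S d 0) ->
    (forall d (c : C) P Q, S d P -> S d Q -> S d (c *: P + Q)) ->
    S 0%N 1 -> (forall d e P Q, S d P -> S e Q -> S (d + e)%N (P * Q)) ->
    (forall a b, S 1%N (M a b)) ->
  S n (\det M).
Proof.
move=> S0 S_lin S1 SM M_S; rewrite /(\det M).
elim/big_rec: _ => // sigma P _ SP.
rewrite mulr_sign -scaler_sign; apply: S_lin => //.
suff : S (\sum_(a < n) 1)%N (\prod_(a < n) M a (sigma a)).
  by rewrite sum1_card card_ord.
by elim/big_rec2: _ => // a d Q _; apply: SM.
Qed.

(** * Wronskians are differentially homogeneous and generate *)

Section Homogeneous.
Variables (C : numFieldType) (N : nat).
Local Notation V := (dpoly C N).
Local Notation I := 'I_N.+1.
Local Notation W k := (wronskian k.+1 (@dvarn C N)).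
Implicit Types (P Q : V) (c : C).

Lemma Vdeg0 d : Vdeg d (0 : V).
Proof. by move=> m; rewrite msupp0 in_fset0. Qed.

Lemma Vdeg_lin d c P Q : Vdeg d P -> Vdeg d Q -> Vdeg d (c *: P + Q).
Proof.
move=> Pd Qd m /(fsubsetP (msuppD_le _ _)); rewrite in_fsetU.
by case/orP=> [/(fsubsetP (msuppZ_le _ _))/Pd|/Qd].
Qed.

Lemma Vdeg1 : Vdeg 0 (1 : V).
Proof. by move=> m; rewrite msuppU1 in_fset1 => /eqP ->; apply: mdeg1. Qed.

Lemma VdegM d e P Q : Vdeg d P -> Vdeg e Q -> Vdeg (d + e) (P * Q).
Proof.
by move=> Pd Qe m /msuppM_le[m1 [m2 [/Pd <- /Qe <- ->]]]; apply: mdegM.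
Qed.

Lemma Vord0 k : Vord k (0 : V).
Proof. by move=> m; rewrite msupp0 in_fset0. Qed.

Lemma Vord_lin k c P Q : Vord k P -> Vord k Q -> Vord k (c *: P + Q).
Proof.
move=> Pk Qk m /(fsubsetP (msuppD_le _ _)); rewrite in_fsetU.
by case/orP=> [/(fsubsetP (msuppZ_le _ _))/Pk|/Qk].
Qed.

Lemma Vord1 k : Vord k (1 : V).
Proof. by move=> m; rewrite msuppU1 in_fset1 => /eqP -> i j; rewrite cm1. Qed.

Lemma VordM k P Q : Vord k P -> Vord k Q -> Vord k (P * Q).
Proof.
move=> Pk Qk m /msuppM_le[m1 [m2 [/Pk m1k /Qk m2k ->]]] i j.
by rewrite cmM addn_eq0 negb_and => /orP[/m1k|/m2k].
Qed.

Lemma Vdiff_deg0 d : Vdiff_deg d (0 : V).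
Proof.
split=> [|a _]; first exact: Vdeg0.
by have := fps_act_lin a (-1) (0 : V) 0; rewrite scaler0 addr0 scaleN1r addNr scaler0.
Qed.

Lemma Vdiff_deg_lin d c P Q :
  Vdiff_deg d P -> Vdiff_deg d Q -> Vdiff_deg d (c *: P + Q).
Proof.
move=> [Pd Ph] [Qd Qh]; split=> [|a ua]; first exact: Vdeg_lin.
by rewrite fps_act_lin Ph // Qh // scalerDr !scalerA mulrC.
Qed.

Lemma Vdiff_deg1 : Vdiff_deg 0 (1 : V).
Proof.
by split=> [|a _]; [apply: Vdeg1 | rewrite fps_act1 scale1r].
Qed.

Lemma Vdiff_degM d e P Q :
  Vdiff_deg d P -> Vdiff_deg e Q -> Vdiff_deg (d + e) (P * Q).
Proof.
move=> [Pd Ph] [Qe Qh]; split=> [|a ua]; first exact: VdegM.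
by rewrite fps_actM Ph // Qh // -scalerAl -scalerAr scalerA exprD.
Qed.

Lemma Vdeg_dvarn i x : Vdeg 1 (dvarn C i x : V).
Proof.
move=> m /(fsubsetP (msuppZ_le _ _)); rewrite msuppU1 in_fset1 => /eqP ->.
exact: mdegU.
Qed.

Lemma Vord_dvarn k i x : (x <= k)%N -> Vord k (dvarn C i x : V).
Proof.
move=> xk m /(fsubsetP (msuppZ_le _ _)); rewrite msuppU1 in_fset1 => /eqP -> j y.
by rewrite cmU eqb0 negbK xpair_eqE => /andP[_ /eqP <-].
Qed.

Lemma Vdiff_deg_wronskian k n w m : size w = n -> size m = n -> (n <= k.+1)%N ->
  Vdiff_deg n (W k w m : V).
Proof.
move=> sz_w sz_m nk; rewrite /wronskian (wronskianE _ sz_w sz_m nk).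
have sz_a (a : 'I_n) : (a < size w)%N by rewrite sz_w.
split=> [|a _]; last first.
  exact: (@wronskian_mx_act C I V (@dvarn C N) n (subst _) a w m (fps_act_dvarn a) sz_w).
apply: (@graded_det C V (fun d => Vdeg d)).
- exact: Vdeg0.
- exact: Vdeg_lin.
- exact: Vdeg1.
- exact: VdegM.
move=> a b; rewrite mxE; case: ifP => _; last exact: Vdeg0.
case: w {sz_w} sz_a => [|i w] /(_ a) // a_lt.
by rewrite (nth_map i) //; apply: Vdeg_dvarn.
Qed.

(** Entries in column b have order at most b < n, whatever the truncation bound k. *)
Lemma Vord_wronskian k l n w m : size w = n -> size m = n -> (n <= k.+1)%N ->
  (n <= l.+1)%N -> Vord l (W k w m : V).
Proof.
move=> sz_w sz_m nk nl; rewrite /wronskian (wronskianE _ sz_w sz_m nk).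
have sz_a (a : 'I_n) : (a < size w)%N by rewrite sz_w.
apply: (@graded_det C V (fun _ => Vord l)) => [_|_|||].
- exact: Vord0.
- exact: Vord_lin.
- exact: Vord1.
- by move=> _ _; apply: VordM.
move=> a b; rewrite mxE; case: ifP => _; last exact: Vord0.
case: w {sz_w} sz_a => [|i w] /(_ a) // a_lt.
rewrite (nth_map i) //; apply: Vord_dvarn.
by rewrite -ltnS (leq_trans _ nl) // (leq_ltn_trans (leq_subr _ _)).
Qed.

(* The unit 1 / (1 - z T), whose action encodes the complete homogeneous
   symmetric functions of the shifts. *)
Lemma fps_unit_geometric (z : C) : fps_unit (fun n => z ^+ n).
Proof.
exists (fun n => if n is n'.+1 then (if n' is 0 then - z else 0) else 1).
apply/funext => -[|n]; first by rewrite /fps_mul big_ord1 mulr1.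
rewrite /fps_mul !big_ord_recr /= subnn subSnn mulr1 mulrN -exprSr.
rewrite big1 ?add0r ?addNr // => j _.
have -> : (n.+1 - j = (n - j).-1.+2)%N by have := ltn_ord j; lia.
by rewrite mulr0.
Qed.

Lemma Vdiff_deg_generated k d P (S : V -> Prop) :
    (forall c P Q, S P -> S Q -> S (c *: P + Q)) ->
    (forall P Q, S P -> S Q -> S (P * Q)) -> S 1 ->
    (forall w m, size m = size w -> (size w <= k.+1)%N ->
      all (fun x => x < k.+1)%N m -> S (W k w m)) ->
  Vdiff_deg d P -> Vord k P -> S P.
Proof.
move=> S_lin SM S1 SW [Pd Ph] Pk.
have := @S_invariant C I V k.+1 (@dvarn C N) (@pderivn C N)
  (fun P => P@_(monalg.one)) (Vord k) (fun d => Vdeg d)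
  (fun z => fps_act (fun n => z ^+ n))
  (@pderivn_lin C N) (@pderivn1 C N) (@pderivn_varM C N) (@mcoeff1_lin C N)
  (@mcoeff1_varM C N) (@Vord_ind C N k) (@Vord_pderivn C N k) (@Vdeg_pderivn C N)
  (@Vdeg0E C N) (@euler_Vdeg C N k) (fun z => fps_act_lin (fun n => z ^+ n))
  (fun z => fps_act1 _ (fun n => z ^+ n)) (fun z => fps_actM (fun n => z ^+ n))
  (fun z => fps_act_dvarn (fun n => z ^+ n)) S S_lin SM S1 SW d P.
apply => // z.
(* The geometric series has constant term 1, so homogeneity gives invariance. *)
by rewrite Ph ?expr1n ?scale1r //; apply: fps_unit_geometric.
Qed.

End Homogeneous.

Local Open Scope classical_set_scope.

(** * Generated subalgebras and generation by the families B_i *)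

Section Subalgebra.
Variables (C : nzRingType) (A : lalgType C).
Implicit Types (S G : set A).

Lemma subalg_closedP S : GRing.subalg_closed (mem S) <->
  [/\ S 1, forall (c : C) P Q, S P -> S Q -> S (c *: P + Q) &
      forall P Q, S P -> S Q -> S (P * Q)].
Proof.
split=> [[S1 S_lin SM]|[S1 S_lin SM]].
  split=> [|c P Q SP SQ|P Q SP SQ]; apply/set_mem => //.
    by apply: S_lin; apply/mem_set.
  by apply: SM; apply/mem_set.
split=> [|c P Q /set_mem SP /set_mem SQ|P Q /set_mem SP /set_mem SQ].
- exact/mem_set.
- exact/mem_set/S_lin.
- exact/mem_set/SM.
Qed.

Lemma sub_gen_subalg G : G `<=` gen_subalg G.
Proof. exact: sub_gen_smallest. Qed.

Lemma gen_subalg_closed G :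
  [/\ gen_subalg G 1,
      forall (c : C) P Q, gen_subalg G P -> gen_subalg G Q ->
        gen_subalg G (c *: P + Q) &
      forall P Q, gen_subalg G P -> gen_subalg G Q -> gen_subalg G (P * Q)].
Proof.
split=> [S [/subalg_closedP[] //]|c P Q GP GQ S SG|P Q GP GQ S SG].
- have [_ S_lin _] := (subalg_closedP S).1 SG.1.
  by apply: S_lin; [apply: GP | apply: GQ].
- have [_ _ SM] := (subalg_closedP S).1 SG.1.
  by apply: SM; [apply: GP | apply: GQ].
Qed.

Lemma gen_subalg_sub G S : GRing.subalg_closed (mem S) -> G `<=` S ->
  gen_subalg G `<=` S.
Proof. exact: smallest_sub. Qed.

End Subalgebra.

Section Main.
Variables (C : numFieldType) (N : nat).
Local Notation V := (dpoly C N).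
Local Notation I := 'I_N.+1.
Local Notation W k := (wronskian k.+1 (@dvarn C N)).
Implicit Types (P Q : V) (c : C).

Lemma Vdiff_of_deg d P : Vdiff_deg d P -> Vdiff P.
Proof.
move=> Pd; exists d.+1, (fun e => if e == d then P else 0); split=> [e|].
  case: eqP => [->|_]; [exact: Pd | exact: Vdiff_deg0].
rewrite big_ord_recr /= eqxx big1 ?add0r // => e _.
by rewrite ltn_eqF.
Qed.

Lemma Vdiff_lin c P Q : Vdiff P -> Vdiff Q -> Vdiff (c *: P + Q).
Proof.
move=> [n [f [f_deg ->]]] [l [g [g_deg ->]]].
(* Padding with zeros brings both families to a common length. *)
pose tr n (h : nat -> V) e := if (e < n)%N then h e else 0.
have trE n' (h : nat -> V) : (n' <= maxn n l)%N ->
    \sum_(e < n') h e = \sum_(e < maxn n l) tr n' h e.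
  by move=> n'_le; rewrite (big_ord_widen _ h n'_le) big_mkcond.
exists (maxn n l), (fun e => c *: tr n f e + tr l g e); split=> [e|].
  have tr_deg n' h : (forall d, Vdiff_deg d (h d)) -> Vdiff_deg e (tr n' h e).
    by rewrite /tr => h_deg; case: ifP => _; [exact: h_deg | exact: Vdiff_deg0].
  exact: Vdiff_deg_lin (tr_deg _ _ f_deg) (tr_deg _ _ g_deg).
by rewrite big_split -scaler_sumr -!trE ?leq_maxl ?leq_maxr.
Qed.

Lemma Vdiff0 : Vdiff (0 : V).
Proof. exact: Vdiff_of_deg (Vdiff_deg0 C N 0). Qed.

Lemma VdiffD P Q : Vdiff P -> Vdiff Q -> Vdiff (P + Q).
Proof. by move=> PV QV; rewrite -[P]scale1r; apply: Vdiff_lin. Qed.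

Lemma VdiffM P Q : Vdiff P -> Vdiff Q -> Vdiff (P * Q).
Proof.
move=> [n [f [f_deg ->]]] [l [g [g_deg ->]]]; rewrite mulr_suml.
elim/big_rec: _ => [|d P' _ P'V]; first exact: Vdiff0.
apply: VdiffD P'V; rewrite mulr_sumr.
elim/big_rec: _ => [|e Q' _ Q'V]; first exact: Vdiff0.
apply: VdiffD Q'V.
exact: Vdiff_of_deg (Vdiff_degM (f_deg d) (g_deg e)).
Qed.

Lemma subalg_Vdiff_ord k : GRing.subalg_closed (mem (@Vdiff_ord C N k)).
Proof.
apply/subalg_closedP; split=> [|c P Q [PV Pk] [QV Qk]|P Q [PV Pk] [QV Qk]].
- split; last exact: Vord1.
  exact: Vdiff_of_deg (Vdiff_deg1 C N).
- by split; [apply: Vdiff_lin | apply: Vord_lin].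
- by split; [apply: VdiffM | apply: VordM].
Qed.

(** Components of distinct degrees have disjoint supports, so nothing cancels and each inherits the
    order bound. *)
Lemma Vdiff_ord_components k P : Vdiff_ord k P ->
  exists n (f : nat -> V), (forall d, Vdiff_deg d (f d)) /\
    (forall d, (d < n)%N -> Vord k (f d)) /\ P = \sum_(d < n) f d.
Proof.
move=> [[n [f [f_deg PE]]] Pk]; exists n, f; split=> //; split=> // d dn m m_fd.
apply: Pk; rewrite -mcoeff_neq0 PE raddf_sum (bigD1 (Ordinal dn)) //= big1 ?addr0.
  by rewrite mcoeff_neq0.
move=> e; rewrite -val_eqE /= => ed; apply: mcoeff_outdom.
apply: contra ed => m_fe; apply/eqP.
by rewrite -((f_deg e).1 m m_fe) ((f_deg d).1 m m_fd).
Qed.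

Lemma Vdiff_ord_sub k (S : set V) : GRing.subalg_closed (mem S) ->
    (forall n w m, size w = n -> size m = n -> (n <= k.+1)%N ->
      all (fun x => x < k.+1)%N m -> S (W k w m)) ->
  @Vdiff_ord C N k `<=` S.
Proof.
move=> /subalg_closedP[S1 S_lin SM] SW P /Vdiff_ord_components.
move=> [n [f [f_deg [f_ord ->]]]].
have S0 : S 0 by have := S_lin (-1) 1 1 S1 S1; rewrite scaleN1r addNr.
elim/big_rec: _ => // d Q _ SQ; rewrite -[f d]scale1r; apply: (S_lin _ _ _ _ SQ).
apply: (Vdiff_deg_generated S_lin SM S1 _ (f_deg d) (f_ord d (ltn_ord d))).
by move=> w m sz_m w_le; apply: SW.
Qed.

Lemma Vdiff_ord_wronskian k n w m : size w = n -> size m = n -> (n <= k.+1)%N ->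
  Vdiff_ord k (W k w m).
Proof.
move=> sz_w sz_m nk; split; last exact: (Vord_wronskian sz_w sz_m nk nk).
exact: Vdiff_of_deg (Vdiff_deg_wronskian C sz_w sz_m nk).
Qed.

Lemma finitely_generated_Vdiff_ord k : finitely_generated (@Vdiff_ord C N k).
Proof.
(* Sizes up to k + 1 and shifts up to k leave finitely many Wronskians. *)
exists (flatten [seq [seq W k w m | w <- words (enum I) n,
    m <- words (iota 0 k.+1) n] | n <- iota 0 k.+2]).
apply/seteqP; split; last first.
  apply: gen_subalg_sub; first exact: subalg_Vdiff_ord.
  move=> P /flatten_mapP[n]; rewrite mem_iota ltnS => n_le.
  case/allpairsP => -[w m] [/size_words sz_w /size_words sz_m ->].
  exact: Vdiff_ord_wronskian sz_w sz_m n_le.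
apply: Vdiff_ord_sub => [|n w m sz_w sz_m n_le m_lt].
  exact/subalg_closedP/gen_subalg_closed.
apply: sub_gen_subalg; apply/flatten_mapP; exists n; first by rewrite mem_iota.
apply: allpairs_f; apply: mem_words => //.
  by apply/allP => i _; rewrite inE mem_enum.
by apply: sub_all m_lt => x; rewrite inE mem_iota.
Qed.

Lemma Vdiff_ord_gen k (B : nat -> set V) :
    (forall i, (1 <= i <= k.+1)%N ->
       basis_mod (@Vdiff_deg_ord_lt C N i i) (@Vdiff_deg_ord_lt C N i i.-1) (B i)) ->
  @Vdiff_ord C N k =
    gen_subalg (\bigcup_(i in [set i : nat | (1 <= i <= k.+1)%N]) B i).
Proof.
move=> B_basis; set G := \bigcup_(i in _) B i.
have [G1 G_lin GM] := gen_subalg_closed G.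
have G0 : gen_subalg G 0 by have := G_lin (-1) 1 1 G1 G1; rewrite scaleN1r addNr.
apply/seteqP; split; last first.
  apply: gen_subalg_sub => [|P [[|i] // ik BP]]; first exact: subalg_Vdiff_ord.
  have [B_sub _ _] := B_basis _ ik; have [P_deg P_ord] := B_sub _ BP.
  split; first exact: Vdiff_of_deg P_deg.
  move=> m mP j y m_jy; apply: leq_trans (P_ord _ mP _ _ m_jy) _.
  by case/andP: ik.
(* Strong induction on the size n; [l] varies because the order bound drops along the induction. *)
have W_gen l n w m : size w = n -> size m = n -> (n <= l.+1)%N -> (n <= k.+1)%N ->
    gen_subalg G (W l w m : V).
  elim/ltn_ind: n l w m => n IHn l w m sz_w sz_m nl nk.
  case: n => [|n] in IHn sz_w sz_m nl nk *.
    case: w m sz_w sz_m => [|//] [|//] _ _.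
    by rewrite /wronskian /= (vdm_nil C) scale1r.
  (* Order at most n - 1 means generation by Wronskians of size at most n, covered by the induction;
     for n = 0 the space is 0 by convention. *)
  have low D : Vdiff_deg_ord_lt n.+1 n D -> gen_subalg G D.
    case: n IHn nk {sz_w sz_m nl} => [|n] IHn nk; first by move=> ->.
    case=> D_deg D_ord; have : Vdiff_ord n D.
      by split; first exact: Vdiff_of_deg D_deg.
    apply: Vdiff_ord_sub => [|p w' m' sz_w' sz_m' pn _]; first exact/subalg_closedP.
    by apply: (IHn p) => //; apply: leq_trans pn (ltnW nk).
  have [|_ _ B_span] := B_basis n.+1; first exact: nk.
  have W_deg := Vdiff_deg_wronskian C (N := N) sz_w sz_m nl.
  have [|s [c [sB QU]]] := B_span (W l w m).
    by split; [exact: W_deg | exact: (Vord_wronskian sz_w sz_m nl)].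
  set Q := \sum_(b <- s) _ in QU.
  have GQ : gen_subalg G Q.
    rewrite /Q big_seq; elim/big_rec: _ => // b P bs GP; apply: G_lin => //.
    by apply: sub_gen_subalg; exists n.+1 => //; apply: sB.
  (* Modulo the combination [Q] of B_(n+1), the Wronskian has lower order. *)
  rewrite -[W l w m](subrK Q) -[_ - Q]scale1r; apply: (G_lin _ _ _ _ GQ).
  exact: low.
apply: Vdiff_ord_sub => [|n w m sz_w sz_m nk _]; first exact/subalg_closedP.
exact: (W_gen k n w m sz_w sz_m nk nk).
Qed.

End Main.

Theorem theorem3p1p1 (R : realType) (N k : nat) (hN : (1 <= N)%N) :
  finitely_generated (@Vdiff_ord R[i] N k) /\
  forall B : nat -> set (dpoly R[i] N),
    (forall i : nat, (1 <= i <= k.+1)%N ->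
       basis_mod (@Vdiff_deg_ord_lt R[i] N i i)
                 (@Vdiff_deg_ord_lt R[i] N i i.-1) (B i)) ->
    @Vdiff_ord R[i] N k =
      gen_subalg (\bigcup_(i in [set i : nat | (1 <= i <= k.+1)%N]) B i).
Proof.
split; first exact: (@finitely_generated_Vdiff_ord R[i] N k).
exact: (@Vdiff_ord_gen R[i] N k).
Qed.
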